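(* Consider the finite-template submatrix detection model (described in the context) with entry laws $\{\mathcal{P}_{\ell,u}\}_{\ell\in[m],\,u\in[k]\times[k]}$ and null entry law $\mathcal{Q}=\mathcal{N}(0,1)$, and let $$\Theta^\star=\max_{\ell\in[m]}\frac{1}{m^2k^2}\log\left(\frac{1}{k^2}\sum_{u\in[k]\times[k]}\exp\left(m^2k^2\,\chi^2(\mathcal{P}_{\ell,u}\Vert\mathcal{Q})\right)\right).$$ Let $\delta=\delta_n>0$ be any sequence such that $\delta_n\to0$ as $n\to\infty$. The following statements hold. 1. Under the non-consecutive placement family $\mathcal{K}_{k,m,n}$: if $$\Theta^\star\le\min\left(\frac1k,\ \frac{n^2\log(1+\delta)}{2m^2k^4}\right),$$ then $d_{\mathsf{TV}}(\mathbb{P}_{\mathcal{H}_0},\mathbb{P}_{\mathcal{H}_1})=o(1)$, and detection is information-theoretically impossible. 2. Under the circular consecutive placement family $\mathcal{K}^{\circ}_{k,m,n}$, assume $k\le\frac n2$. If $$\Theta^\star\le\frac{1}{k^2}\log\left(1+\frac{n^2\log(1+\delta)}{4k^2m^2}\right),$$ then $d_{\mathsf{TV}}(\mathbb{P}_{\mathcal{H}_0},\mathbb{P}_{\mathcal{H}_1})=o(1)$, and detection is information-theoretically impossible.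
   Context: **Asymptotics.** All asymptotic statements are as $n\to\infty$; $m=m(n)$, $k=k(n)$ are positive integers with $mk\le n$, and the laws $\mathcal{P}_{\ell,u}$ may depend on $n$. $[k]=\{1,\dots,k\}$. **Blocks and placements.** $\mathcal{B}_{k,n}=\{S\times T: S,T\subset[n],\ |S|=|T|=k\}$. $\mathcal{B}^{\circ}_{k,n}$ is the set of $S\times T$ with $S,T\in\{\{i+1,\dots,i+k\}\bmod n: i=0,\dots,n-1\}$, indices taken modulo $n$ with representatives in $[n]$. The non-consecutive placement family $\mathcal{K}_{k,m,n}$ and the circular consecutive placement family $\mathcal{K}^{\circ}_{k,m,n}$ are the sets of all unordered collections of $m$ pairwise disjoint blocks from $\mathcal{B}_{k,n}$ and $\mathcal{B}^{\circ}_{k,n}$, respectively. For a block $B=S\times T$ with $S=\{s_1<\dots<s_k\}$, $T=\{t_1<\dots<t_k\}$, the coordinate map $\varphi_B:B\to[k]\times[k]$ is $\varphi_B(s_u,t_v)=(u,v)$. **Finite-template model.** For $\ell\in[m]$, $u\in[k]\times[k]$, $\mathcal{P}_{\ell,u}$ is a probability distribution on $\mathbb{R}$ with $\mathcal{P}_{\ell,u}\ll\mathcal{Q}$. (The two Gaussian specializations of interest are the mean-shift model $\mathcal{P}_{\ell,u}=\mathcal{N}((M_\ell)_u,1)$ with $M_\ell\in\mathbb{R}^{k\times k}$, and the variance-shift model $\mathcal{P}_{\ell,u}=\mathcal{N}(0,1+(\Sigma_\ell)_u)$ with $0\le(\Sigma_\ell)_u\le\vartheta_0$ for a fixed $\vartheta_0\in[0,1)$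 independent of $n$.) One observes $X\in\mathbb{R}^{n\times n}$. Under $\mathcal{H}_0$ the entries are i.i.d. $\mathcal{Q}$ (law $\mathbb{P}_{\mathcal{H}_0}$). Under $\mathcal{H}_1$, $K$ is drawn uniformly from the specified placement family, then, conditional on $K$, a bijection $\beta:K\to[m]$ is drawn uniformly; given $(K,\beta)$ the entries of $X$ are independent with $X_{ij}\sim\mathcal{P}_{\beta(B),\varphi_B(i,j)}$ if $(i,j)\in B$ for some $B\in K$, and $X_{ij}\sim\mathcal{Q}$ otherwise. $\mathbb{P}_{\mathcal{H}_1}$ is the resulting marginal (mixture) law of $X$. **Divergences.** $\chi^2(\mathbb{P}\Vert\mathbb{Q})=\int(\mathrm{d}\mathbb{P}/\mathrm{d}\mathbb{Q}-1)^2\mathrm{d}\mathbb{Q}$ for $\mathbb{P}\ll\mathbb{Q}$, and $d_{\mathsf{TV}}(\mathbb{P},\mathbb{Q})=\frac12\int|\mathrm{d}\mathbb{P}-\mathrm{d}\mathbb{Q}|$. ''Detection is information-theoretically impossible'' means $d_{\mathsf{TV}}(\mathbb{P}_{\mathcal{H}_0},\mathbb{P}_{\mathcal{H}_1})=o(1)$, equivalently that the minimal risk $\inf_{\mathcal{A}}\{\mathbb{P}_{\mathcal{H}_0}(\mathcal{A}(X)=1)+\mathbb{P}_{\mathcal{H}_1}(\mathcal{A}(X)=0)\}$ over all tests tends to $1$. *)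

(* Defs.v *)
From HB Require Import structures.
From mathcomp Require Import all_boot all_order all_algebra.
From mathcomp Require Import all_classical all_reals all_analysis.

Set Implicit Arguments.
Unset Strict Implicit.
Unset Printing Implicit Defensive.

Import Order.TTheory GRing.Theory Num.Theory.
Import numFieldNormedType.Exports.

Local Open Scope classical_set_scope.
Local Open Scope ring_scope.
Local Open Scope charge_scope.
Local Open Scope ereal_scope.

Section tuple_law.
Context {d : measure_display} {T : measurableType d} {R : realType}.

Definition tuple_cons n (x : T * n.-tuple T) : n.+1.-tuple T :=
  [tuple of x.1 :: x.2].

Lemma measurable_tuple_cons n :
  measurable_fun [set: T * n.-tuple T] (@tuple_cons n).
Proof. exact: measurable_cons. Qed.

HB.instance Definition _ n :=
  isMeasurableFun.Build _ _ _ _ (@tuple_cons n) (@measurable_tuple_cons n).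

(* The law of a tuple with independent coordinates, the i-th one of law P i;
   [tuple_law_box] is its defining property. *)
Fixpoint tuple_law n : ('I_n -> probability T R) -> probability (n.-tuple T) R :=
  match n with
  | 0 => fun _ => \d_([tuple] : 0.-tuple T)
  | n'.+1 => fun P =>
      distribution (P ord0 \x tuple_law (fun i => P (lift ord0 i)))
                   (@tuple_cons n')
  end.

Lemma tuple_law_box n (P : 'I_n -> probability T R) (B : 'I_n -> set T) :
  (forall i, measurable (B i)) ->
  tuple_law P [set x | forall i, B i (tnth x i)] = \prod_(i < n) P i (B i).
Proof.
elim: n P B => [|n IH] P B mB.
  rewrite big_ord0 /= diracE mem_set//=.
  by case.
rewrite big_ord_recl /= /distribution /pushforward.
rewrite (_ : _ @^-1` _ =
  B ord0 `*` [set x | forall i, B (lift ord0 i) (tnth x i)]); last first.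
  apply/seteqP; split => [x /= Bx|x /= [B0 Bx] i].
    split; first exact: (Bx ord0).
    by move=> i; have := Bx (lift ord0 i); rewrite tnthS.
  by case: (unliftP ord0 i) => [j ->|->//]; rewrite tnthS.
rewrite product_measure1E//; first by congr (_ * _); exact: (IH _ (fun i => B (lift ord0 i))).
rewrite (_ : [set x | _] =
  \bigcap_(i in [set: 'I_n]) ((@tnth n T)^~ i @^-1` B (lift ord0 i))); last first.
  by apply/seteqP; split => [x Bx i _|x Bx i]; [exact: Bx|exact: (Bx i)].
apply: fin_bigcap_measurable => // i _.
by rewrite -[X in measurable X]setTI; exact: measurable_tnth.
Qed.

End tuple_law.

Section uniform_mixture.
Context {d : measure_display} {T : measurableType d} {R : realType}.
Context {I : finType}.
Variables (A : {set I}) (mu : I -> {finite_measure set T -> \bar R}).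

(* The law of an observation drawn from [mu i], where [i] is uniform on [A];
   it is the zero measure if [A] is empty. *)
Definition uniform_mixture (X : set T) : \bar R :=
  \sum_(i in A) (#|A|%:R^-1)%:E * mu i X.

Let uniform_mixture0 : uniform_mixture set0 = 0.
Proof. by rewrite /uniform_mixture big1// => i _; rewrite measure0 mule0. Qed.

Let uniform_mixture_ge0 X : 0 <= uniform_mixture X.
Proof. by apply: sume_ge0 => i _; rewrite mule_ge0. Qed.

Let uniform_mixture_sigma_additive : semi_sigma_additive uniform_mixture.
Proof.
move=> F mF tF mUF; rewrite [X in _ --> X](_ : _ =
    lim ((fun n => \sum_(0 <= i < n) uniform_mixture (F i)) @ \oo)).
  by apply: is_cvg_ereal_nneg_natsum => k _; exact: uniform_mixture_ge0.
rewrite nneseries_sum//; last by move=> *; rewrite mule_ge0.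
apply: eq_bigr => /= i _.
rewrite nneseriesZl; last by move=> *; exact: measure_ge0.
by congr (_ * _); exact: measure_semi_bigcup.
Qed.

HB.instance Definition _ := isMeasure.Build _ _ _ uniform_mixture
  uniform_mixture0 uniform_mixture_ge0 uniform_mixture_sigma_additive.

Let uniform_mixture_finite : fin_num_fun uniform_mixture.
Proof.
move=> X mX; apply/sum_fin_numP => i _ _.
by rewrite fin_numM// fin_num_measure.
Qed.

HB.instance Definition _ := Measure_isFinite.Build _ _ _ uniform_mixture
  uniform_mixture_finite.

End uniform_mixture.

Section divergences.
Context {d : measure_display} {T : measurableType d} {R : realType}.

Section finite_measure_add.
Variables mu nu : {finite_measure set T -> \bar R}.

HB.instance Definition _ := Measure.on (measure_add mu nu).

Let measure_add_finite : fin_num_fun (measure_add mu nu).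
Proof.
by move=> X mX; rewrite measure_addE fin_numD !fin_num_measure.
Qed.

HB.instance Definition _ := Measure_isFinite.Build _ _ _ (measure_add mu nu)
  measure_add_finite.
End finite_measure_add.

Definition chi2_div (P Q : probability T R) : \bar R :=
  \int[Q]_x ('d (charge_of_finite_measure P) '/d Q x - 1) ^+ 2.

(* |dP - dQ| is computed with densities with respect to P + Q. The arguments are
   finite measures because [uniform_mixture] has mass 0 over an empty set. *)
Definition dTV (P Q : {finite_measure set T -> \bar R}) : \bar R :=
  (2^-1)%:E *
  \int[measure_add P Q]_x
    `| 'd (charge_of_finite_measure P) '/d (measure_add P Q) x
       - 'd (charge_of_finite_measure Q) '/d (measure_add P Q) x |.

(* The infimum ranges over the measurable tests A, with A x = true meaning that
   the null hypothesis P0 is rejected. *)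
Definition minimal_risk (P0 P1 : {finite_measure set T -> \bar R}) : \bar R :=
  ereal_inf [set P0 [set x | A x = true] + P1 [set x | A x = false]
            | A in [set A : T -> bool | measurable_fun setT A]].

End divergences.

Section placements.
Variable n : nat.

(* The block S x T is represented by the pair (S, T); indices in {1, ..., n}
   are shifted to {0, ..., n - 1}. *)
Definition block := ({set 'I_n} * {set 'I_n})%type.

Definition cells (B : block) : {set 'I_n * 'I_n} := finset.setX B.1 B.2.

Definition blocks (k : nat) : {set block} :=
  [set B : block | (#|B.1| == k) && (#|B.2| == k)].

(* {i+1, ..., i+k} mod n with representatives in {1, ..., n}, after the shift. *)
Definition cyclic_interval (k : nat) (i : 'I_n) : {set 'I_n} :=
  [set j : 'I_n | [exists r : 'I_k, nat_of_ord j == (i + r) %% n]%N].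

Definition circ_blocks k : {set block} :=
  [set B : block | [exists i, B.1 == cyclic_interval k i]
                   && [exists i, B.2 == cyclic_interval k i]].

Definition placements (m : nat) (bl : {set block}) : {set {set block}} :=
  [set K : {set block} | [&& #|K| == m, K \subset bl &
    [forall B in K, forall B' in K,
       (B != B') ==> [disjoint cells B & cells B']]]].

Definition nc_family k m : {set {set block}} := placements m (blocks k).

Definition circ_family k m : {set {set block}} := placements m (circ_blocks k).

Definition labelings m (K : {set block}) : {set {ffun {B | B \in K} -> 'I_m}} :=
  [set b : {ffun {B | B \in K} -> 'I_m} | `[< bijective b >]].

(* The coordinate map phi_B, with 0-based values. [enum] lists a set of ordinals
   increasingly, so [index i (enum S)] is the rank of [i] in [S]; the value is
   [Some] exactly on the cells of B when B has k rows and k columns. *)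
Definition block_coord k (B : block) (ij : 'I_n * 'I_n) :
    option ('I_k * 'I_k) :=
  match insub (index ij.1 (enum B.1)), insub (index ij.2 (enum B.2)) with
  | Some u, Some v => Some (u, v)
  | _, _ => None
  end.

End placements.

Section model.
Context {R : realType}.
Local Notation RR := (measurableTypeR R).

Definition std_normal : probability RR R := normal_prob (0%R : R) 1%R.

Section fixed_size.
Context {n m k : nat}.
Variable P : 'I_m -> 'I_k * 'I_k -> probability RR R.

Definition entry_law (K : {set block n}) (b : {ffun {B | B \in K} -> 'I_m})
    (ij : 'I_n * 'I_n) : probability RR R :=
  if [pick B : {B | B \in K} | ij \in cells (val B)] is Some B then
    if block_coord k (val B) ij is Some u then P (b B) u else std_normal
  else std_normal.

(* Law on R^{n x n} (n-tuples of rows) with independent entries. *)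
Definition matrix_law (E : 'I_n * 'I_n -> probability RR R) :
    probability (n.-tuple (n.-tuple RR)) R :=
  tuple_law (fun i => tuple_law (fun j => E (i, j))).

Definition law_H1 (F : {set {set block n}}) :
    {finite_measure set (n.-tuple (n.-tuple RR)) -> \bar R} :=
  uniform_mixture F (fun K =>
    uniform_mixture (labelings m K) (fun b => matrix_law (entry_law b))).

(* Extended-real valued, since a chi-square divergence may be +oo. *)
Definition Theta_star : \bar R :=
  \big[maxe/-oo]_(l < m)
    (((m ^ 2 * k ^ 2)%:R^-1)%:E *
     lne (((k ^ 2)%:R^-1)%:E *
          \sum_(u : 'I_k * 'I_k)
            expeR ((m ^ 2 * k ^ 2)%:R%:E * chi2_div (P l u) std_normal))).

End fixed_size.

Definition law_H0 n : probability (n.-tuple (n.-tuple RR)) R :=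
  matrix_law (fun _ => std_normal).

End model.

(* Main.v *)
(** Likelihood ratios are compared through a truncated second moment. If two
    placements [t] and [t'] have likelihood ratios [L], [L'], then
    [E_0 (L L')] is at most the average of [exp (overlap t t')] and
    [exp (overlap t' t)], where [overlap t t'] sums the chi-square weights of
    [t] over the cells also covered by [t'].

    Circular family: for fixed [t] the exponential factorises over the blocks of
    [t'], and resampling one block of [t'] given the others costs at most a
    factor 2 in density, since the other blocks exclude at most half of the
    positions when [8 k <= n]. When [8 k > n] there are fewer than 8 blocks and
    the overlap is bounded by the total weight.

    Non-consecutive family: uniform placements of disjoint blocks are strongly
    dependent, so a placement is written as a random row and column permutation
    of another one, and the second moment is taken over the permutations only
    (by convexity of the total variation). For permutations,
    [E prod (1 + y j (tau j)) <= exp (e/n sum y)]. Applying this to columns, then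
    to rows, gives [exp (C m^2 k^4 theta / n^2)] as soon as the numbers of blocks
    meeting a column, or a row, have bounded exponential moments. That moment
    bound holds on average: as [m k <= n], a column of degree at least 2 forces
    empty columns to exist, and moving it in two blocks at a time to an empty
    column shows that column degrees have factorial tails. *)
Require Import Defs.
From mathcomp Require Import all_boot all_order fingroup perm all_algebra.
From mathcomp Require Import all_classical all_reals all_analysis.
From mathcomp Require Import measurable_realfun ring lra zify.

Set Implicit Arguments.
Unset Strict Implicit.
Unset Printing Implicit Defensive.

Import Order.TTheory GRing.Theory Num.Theory.
Import numFieldNormedType.Exports.

Local Open Scope classical_set_scope.
Local Open Scope ring_scope.


(** * Densities of product laws *)

Section density.
Local Open Scope ereal_scope.
Context {d : measure_display} {T : measurableType d} {R : realType}.

(** The overlap is asymmetric on purpose. Permuting rows and columns scrambles the ranks inside a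
    block, so the template of a permuted placement is not the permuted template; only the set of
    covered cells follows the permutation. As [overlap t t'] sees [t'] through its covered cells
    alone, [t'] can be averaged over permutations all the same.

    In the non-consecutive family, the cap [1 / k] on the threshold bounds every cell weight by
    [3 / k]. Weights collected along a row or a column are then at most 3 times a degree, whatever
    [k] is. This is the origin of the number 3 in the exponents, and the reason why exponential
    moments of degrees are needed.

    Constants may depend on the target error: both hypotheses bound the exponent of the second
    moment by a constant times [ln (1 + delta n)], which tends to 0 for any fixed constant. Hence
    Markov's inequality suffices to discard placements with large degree moments, at a truncation
    level that grows as the target error shrinks. *)

Definition is_density (nu mu : {measure set T -> \bar R}) (f : T -> R) :=
  [/\ measurable_fun setT f, forall x, (0 <= f x)%R &
      forall h : T -> \bar R, measurable_fun setT h -> (forall x, 0 <= h x) ->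
        \int[nu]_x h x = \int[mu]_x (h x * (f x)%:E)].

Lemma is_density_set nu mu f (A : set T) : is_density nu mu f ->
  measurable A -> nu A = \int[mu]_(x in A) (f x)%:E.
Proof.
move=> [mf f0 H] mA; rewrite -(setIT A) -integral_indic// H//.
- rewrite setIT [RHS]integral_mkcond; apply: eq_integral => x _.
  rewrite patchE indicE; case: ifP => xA; first by rewrite mul1e.
  by rewrite mul0e.
- exact/measurable_EFinP.
Qed.

Lemma is_density_cst1 mu : is_density mu mu (cst 1%R).
Proof. by split=> // h _ _; apply: eq_integral => x _; rewrite mule1. Qed.

Definition rn_density (nu mu : probability T R) : T -> R :=
  fine \o Radon_Nikodym_SigmaFinite.f nu mu.

Lemma is_density_rn (nu mu : probability T R) : nu `<< mu ->
  is_density nu mu (rn_density nu mu).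
Proof.
move=> numu.
have fE x : (rn_density nu mu x)%:E = Radon_Nikodym_SigmaFinite.f nu mu x.
  by rewrite /rn_density /= fineK// Radon_Nikodym_SigmaFinite.f_fin_num.
split.
- apply/measurable_EFinP; rewrite (_ : _ \o _ = Radon_Nikodym_SigmaFinite.f nu mu).
    by apply: measurable_int; exact: Radon_Nikodym_SigmaFinite.f_integrable.
  by apply/funext => x /=; rewrite fE.
- by move=> x; rewrite fine_ge0// Radon_Nikodym_SigmaFinite.f_ge0.
- move=> h mh h0; under [RHS]eq_integral do rewrite fE.
  by rewrite Radon_Nikodym_SigmaFinite.change_of_variables.
Qed.

(** [chi2_div] is written with the derivative of a charge, [rn_density] with the sigma-finite
    construction, which is finite everywhere. The two agree almost everywhere. *)
Lemma chi2_div_rn (nu mu : probability T R) : nu `<< mu ->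
  chi2_div nu mu = \int[mu]_x ((rn_density nu mu x - 1) ^+ 2)%:E.
Proof.
move=> numu; have [mf _ _] := is_density_rn numu.
apply: ae_eq_integral => //.
- under eq_fun do rewrite expe2.
  by apply: emeasurable_funM; apply: emeasurable_funB.
- apply/measurable_EFinP; apply: measurable_funX; exact: measurable_funB.
- have := ae_eq_Radon_Nikodym_SigmaFinite numu measurableT.
  apply: filterS => x /= /(_ I) xE _.
  rewrite -xE EFin_expe EFinB /rn_density /= fineK//.
  exact: Radon_Nikodym_SigmaFinite.f_fin_num.
Qed.

End density.

Section tuple_law_density.
Local Open Scope ereal_scope.
Context {d : measure_display} {T : measurableType d} {R : realType}.

Lemma integral_tuple_lawS n (P : 'I_n.+1 -> probability T R)
    (h : n.+1.-tuple T -> \bar R) :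
  measurable_fun setT h -> (forall x, 0 <= h x) ->
  \int[tuple_law P]_x h x = \int[P ord0]_x
    \int[tuple_law (fun i => P (lift ord0 i))]_y h (tuple_cons (x, y)).
Proof.
move=> mh h0.
rewrite (ge0_integral_distribution (@tuple_cons d T n))//.
rewrite fubini_tonelli1//; last by move=> x; exact: h0.
exact: (measurableT_comp mh (@measurable_tuple_cons _ _ n)).
Qed.

Lemma measurable_tuple_cons2 n x :
  measurable_fun setT (fun y : n.-tuple T => tuple_cons (x, y)).
Proof.
exact: (measurableT_comp (@measurable_tuple_cons _ _ n) (pair1_measurable x)).
Qed.

Lemma integral_tuple_law0 (P : 'I_0 -> probability T R) (h : 0.-tuple T -> \bar R) :
  measurable_fun setT h -> \int[tuple_law P]_x h x = h [tuple].
Proof. by move=> mh; rewrite /= integral_dirac// diracT mul1e. Qed.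

Lemma measurable_prod_tnth n (f : 'I_n -> T -> R) :
  (forall i, measurable_fun setT (f i)) ->
  measurable_fun setT (fun x : n.-tuple T => (\prod_(i < n) f i (tnth x i))%R).
Proof.
move=> mf; apply: measurable_prod => i _.
apply: measurableT_comp => //; exact: measurable_tnth.
Qed.

(** Tonelli, one coordinate at a time. Densities are tested against nonnegative functions rather
    than events so that the induction hypothesis applies to the sections of [h]. *)
Lemma is_density_tuple_law n (P' P : 'I_n -> probability T R) (f : 'I_n -> T -> R) :
  (forall i, is_density (P' i) (P i) (f i)) ->
  is_density (tuple_law P') (tuple_law P) (fun x => \prod_(i < n) f i (tnth x i))%R.
Proof.
move=> H; split.
- by apply: measurable_prod_tnth => i; have [] := H i.
- by move=> x; apply: prodr_ge0 => i _; have [_ + _] := H i.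
- elim: n P' P f H => [|n IH] P' P f H h mh h0.
    rewrite !integral_tuple_law0 ?big_ord0 ?mule1//.
    rewrite (_ : (fun _ => _) = h)//.
    by apply/funext => x; rewrite big_ord0 mule1.
  rewrite !integral_tuple_lawS//; last 2 first.
  + apply: emeasurable_funM => //; apply/measurable_EFinP.
    by apply: measurable_prod_tnth => i; have [] := H i.
  + move=> x; rewrite mule_ge0// lee_fin; apply: prodr_ge0 => i _.
    by have [_ + _] := H i.
  have [mf0 f00 ->] := H ord0; last 2 first.
  + apply: (measurable_fun_fubini_tonelli_F (h \o @tuple_cons d T n)) => //.
    exact: (measurableT_comp mh (@measurable_tuple_cons _ _ n)).
      by move=> x; exact: h0.
  + by move=> x; apply: integral_ge0.
  apply: eq_integral => x _.
  rewrite (IH _ _ _ (fun i => H (lift ord0 i))); last 2 first.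
  + exact: (measurableT_comp mh (@measurable_tuple_cons2 _ x)).
  + by [].
  rewrite muleC -ge0_integralZl//; last 3 first.
  + apply: emeasurable_funM.
      exact: (measurableT_comp mh (@measurable_tuple_cons2 _ x)).
    apply/measurable_EFinP.
    apply: (@measurable_prod_tnth _ (fun i => f (lift ord0 i))) => i.
    by have [] := H (lift ord0 i).
  + move=> y _; rewrite mule_ge0// lee_fin; apply: prodr_ge0 => i _.
    by have [_ + _] := H (lift ord0 i).
  + by rewrite lee_fin.
  apply: eq_integral => y _; rewrite muleCA; congr (_ * _).
  rewrite -EFinM big_ord_recl; congr (_ * _)%:E.
  by apply: eq_bigr => i _; rewrite tnthS.
Qed.

Lemma integral_tuple_law_prod n (P : 'I_n -> probability T R) (f : 'I_n -> T -> R) :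
  (forall i, measurable_fun setT (f i)) -> (forall i x, 0 <= f i x)%R ->
  \int[tuple_law P]_x (\prod_(i < n) f i (tnth x i))%:E =
  \prod_(i < n) \int[P i]_x (f i x)%:E.
Proof.
elim: n P f => [|n IH] P f mf f0.
  rewrite integral_tuple_law0 ?big_ord0// (_ : (fun _ => _) = cst 1)//.
  by apply/funext => x; rewrite big_ord0.
rewrite integral_tuple_lawS//; last 2 first.
- apply/measurable_EFinP; exact: measurable_prod_tnth.
- by move=> x; rewrite lee_fin prodr_ge0.
rewrite big_ord_recl -(IH (fun i => P (lift ord0 i)) (fun i => f (lift ord0 i)))//.
rewrite muleC -ge0_integralZl//; last 3 first.
- exact/measurable_EFinP.
- by move=> x _; rewrite lee_fin.
- by apply: integral_ge0 => x _; rewrite lee_fin prodr_ge0.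
apply: eq_integral => x _.
rewrite muleC -ge0_integralZl//; last 3 first.
- apply/measurable_EFinP.
  exact: (@measurable_prod_tnth _ (fun i => f (lift ord0 i))).
- by move=> y _; rewrite lee_fin prodr_ge0.
- by rewrite lee_fin.
apply: eq_integral => y _; rewrite -EFinM big_ord_recl; congr (_ * _)%:E.
by apply: eq_bigr => i _; rewrite tnthS.
Qed.

End tuple_law_density.

(** * Total variation and minimal risk from bounds on events *)

Section testing.
Local Open Scope ereal_scope.
Local Open Scope charge_scope.
Context {d : measure_display} {T : measurableType d} {R : realType}.

Lemma dTV_ge0 (P Q : {finite_measure set T -> \bar R}) : 0 <= dTV P Q.
Proof. by rewrite /dTV mule_ge0// integral_ge0. Qed.

(** Cut the space along the event where the density of [P] dominates that of [Q]. Each half of the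
    integral is a difference of [P] and [Q] on one event, hence at most [e]; the factor one half
    compensates for having two of them. Total masses need not agree. *)
Lemma dTV_le (P Q : {finite_measure set T -> \bar R}) (e : R) :
  (forall A, measurable A -> `|P A - Q A| <= e%:E) -> dTV P Q <= e%:E.
Proof.
move=> H; rewrite /dTV.
pose m : {finite_measure set T -> \bar R} := measure_add P Q.
have mE A : m A = P A + Q A by exact: measure_addE.
rewrite -/m.
have Pm : P `<< m.
  apply/null_content_dominatesP => A mA mA0.
  have /eqP : P A + Q A = 0 by rewrite -mE; exact: mA0.
  by rewrite padde_eq0// => /andP[/eqP].
have Qm : Q `<< m.
  apply/null_content_dominatesP => A mA mA0.
  have /eqP : P A + Q A = 0 by rewrite -mE; exact: mA0.
  by rewrite padde_eq0// => /andP[_ /eqP].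
set f := 'd (charge_of_finite_measure P) '/d m.
set g := 'd (charge_of_finite_measure Q) '/d m.
have intf : m.-integrable setT f by exact: Radon_Nikodym_integrable.
have intg : m.-integrable setT g by exact: Radon_Nikodym_integrable.
have mf := measurable_int _ intf; have mg := measurable_int _ intg.
have ffin x : f x \is a fin_num by exact: Radon_Nikodym_fin_num.
have gfin x : g x \is a fin_num by exact: Radon_Nikodym_fin_num.
pose A := [set x | g x <= f x].
have mA : measurable A by rewrite /A -[X in measurable X]setTI; exact: measurable_lee.
have mCA : measurable (~` A) by exact: measurableC.
have PE B : measurable B -> P B = \int[m]_(x in B) f x.
  by move=> mB; exact: (@Radon_Nikodym_integral _ _ _ (charge_of_finite_measure P)).
have QE B : measurable B -> Q B = \int[m]_(x in B) g x.
  by move=> mB; exact: (@Radon_Nikodym_integral _ _ _ (charge_of_finite_measure Q)).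
rewrite -(setUv A) ge0_integral_setU//; last 2 first.
- by apply: measurable_funTS; apply: measurableT_comp => //; exact: emeasurable_funB.
- exact/disj_set2P/setICr.
have -> : \int[m]_(x in A) `|f x - g x| = P A - Q A.
  rewrite (PE A)// (QE A)// -integralB//; [|exact: integrableS (intf)|exact: integrableS (intg)].
  apply: eq_integral => x; rewrite inE /A /= => gf; rewrite gee0_abs//.
  by rewrite sube_ge0// (gfin x).
have -> : \int[m]_(x in ~` A) `|f x - g x| = Q (~` A) - P (~` A).
  rewrite (PE _ mCA)// (QE _ mCA)// -integralB//;
    [|exact: integrableS (intg)|exact: integrableS (intf)].
  apply: eq_integral => x; rewrite inE /A /= => /negP; rewrite -ltNge => gf.
  rewrite lee0_abs; last by rewrite sube_le0 ltW.
  by rewrite -(fineK (ffin x)) -(fineK (gfin x)) -!EFinB -EFinN opprB.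
have H1 := le_trans (lee_abs _) (H A mA).
have H2 : Q (~` A) - P (~` A) <= e%:E.
  have := H _ mCA.
  have P1 : P (~` A) \is a fin_num by exact: fin_num_measure.
  have Q1 : Q (~` A) \is a fin_num by exact: fin_num_measure.
  rewrite -(fineK P1) -(fineK Q1) -!EFinB !lee_fin ler_norml.
  by move=> /andP[+ _]; lra.
have := leeD H1 H2; rewrite -EFinD => H3.
apply: le_trans (lee_wpmul2l _ H3) _; first by rewrite lee_fin invr_ge0.
by rewrite -EFinM lee_fin; lra.
Qed.

(** The two errors of a test add up to 1 plus the difference of [Q] and [P] on the acceptance
    region. The upper bound comes from the test that never rejects. *)
Lemma minimal_risk_bounds (P : probability T R) (Q : {finite_measure set T -> \bar R}) (e : R) :
  Q setT = 1 ->
  (forall A, measurable A -> `|P A - Q A| <= e%:E) ->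
  1 - e%:E <= minimal_risk P Q <= 1.
Proof.
move=> Q1 H; apply/andP; split.
- apply: le_ereal_inf_tmp => _ [A mA <-].
  have mAt : measurable [set x | A x = true].
    by rewrite -[X in measurable X]setTI; exact: (mA measurableT [set true]).
  have -> : [set x | A x = false] = ~` [set x | A x = true].
    by apply/seteqP; split => x /=; case: (A x).
  have := le_trans (lee_abs _) (H _ (measurableC mAt)).
  set B := [set x | A x = true] in mAt *.
  rewrite probability_setC// => K.
  have PB : P B \is a fin_num by exact: fin_num_measure.
  have QB : Q (~` B) \is a fin_num by apply: fin_num_measure; exact: measurableC.
  change (1 - e%:E <= P B + Q (~` B)).
  move: K PB QB; case: (P B) => [p| |] //; case: (Q _) => [q| |] // + _ _.
  by rewrite -!EFinB -EFinD !lee_fin; lra.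
- rewrite /minimal_risk; apply: ereal_inf_lbound => /=; exists (fun=> false); first exact: measurable_cst.
  rewrite (_ : [set _ | _ = true] = set0); last by apply/seteqP; split.
  rewrite (_ : [set _ | _ = false] = setT); last by apply/seteqP; split.
  by rewrite measure0 add0e Q1.
Qed.

End testing.

(** * Second moment of a mixture of likelihood ratios *)

Section second_moment.
Local Open Scope ereal_scope.
Context {d : measure_display} {T : measurableType d} {R : realType}.

(* Truncated second moment method: the weights [c] need not add up to 1. *)
Lemma second_moment_bound (P0 : probability T R) (H : finType) (L : H -> T -> R)
    (nu : H -> probability T R) (c : H -> R) (B : H -> H -> R) (e : R) (A : set T) :
  (forall h, is_density (nu h) P0 (L h)) ->
  (forall h, 0 <= c h)%R ->
  (forall h h', \int[P0]_x (L h x * L h' x)%:E <= (B h h')%:E) ->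
  (0 < e)%R -> measurable A ->
  (`|\sum_h c h * fine (nu h A) - fine (P0 A)| <=
   e / 2 + ((\sum_h \sum_h' c h * c h' * B h h') - 2 * \sum_h c h + 1) / (2 * e))%R.
Proof.
move=> dL c0 LB e0 mA.
pose M x := (\sum_h c h * L h x)%R.
have mL h : measurable_fun [set: T] (L h) by have [] := dL h.
have L0 h x : (0 <= L h x)%R by have [_ + _] := dL h.
have mM : measurable_fun [set: T] M.
  by apply: measurable_sum => h; apply: measurable_funM.
have M0 x : (0 <= M x)%R by apply: sumr_ge0 => h _; rewrite mulr_ge0.
have intM D : measurable D -> \int[P0]_(x in D) (M x)%:E = (\sum_h c h * fine (nu h D))%:E.
  move=> mD; under eq_integral do rewrite /M -sumEFin.
  rewrite ge0_integral_sum//; last 2 first.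
  - move=> h; apply/measurable_EFinP/measurable_funTS; exact: measurable_funM.
  - by move=> h x _; rewrite lee_fin mulr_ge0.
  rewrite -sumEFin; apply: eq_bigr => h _.
  under eq_integral do rewrite EFinM.
  rewrite ge0_integralZl//; last 3 first.
  - apply/measurable_EFinP/measurable_funTS; exact: mL.
  - by move=> x _; rewrite lee_fin.
  - by rewrite lee_fin.
  by rewrite -(is_density_set (dL h) mD) EFinM fineK// fin_num_measure.
have intM2 : \int[P0]_x (M x ^+ 2)%:E <= (\sum_h \sum_h' c h * c h' * B h h')%:E.
  have M2E x : ((M x) ^+ 2)%:E = \sum_h \sum_h' (c h * c h')%:E * (L h x * L h' x)%:E.
    rewrite expr2 {1}/M mulr_suml -sumEFin; apply: eq_bigr => h _.
    rewrite /M mulr_sumr -sumEFin; apply: eq_bigr => h' _.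
    by rewrite -EFinM mulrACA.
  under eq_integral do rewrite M2E.
  have mLL h h' : measurable_fun [set: T] (fun x => (L h x * L h' x)%:E).
    by apply/measurable_EFinP; exact: measurable_funM.
  rewrite ge0_integral_sum//; last 2 first.
  - move=> h; apply: emeasurable_sum => h'; apply: emeasurable_funM => //.
  - move=> h x _; apply: sume_ge0 => h' _; rewrite -EFinM lee_fin.
    by rewrite !mulr_ge0.
  rewrite -sumEFin; apply: lee_sum => h _.
  rewrite ge0_integral_sum//; last 2 first.
  - by move=> h'; apply: emeasurable_funM.
  - by move=> h' x _; rewrite -EFinM lee_fin !mulr_ge0.
  rewrite -sumEFin; apply: lee_sum => h' _.
  rewrite ge0_integralZl//; last 2 first.
  - by move=> x _; rewrite lee_fin !mulr_ge0.
  - by rewrite lee_fin mulr_ge0.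
  by rewrite (EFinM (_ * _)) lee_wpmul2l// lee_fin mulr_ge0.
have s1 : (\sum_h c h * fine (nu h setT) = \sum_h c h)%R.
  by apply: eq_bigr => h _; rewrite probability_setT /= mulr1.
set s := (\sum_h c h)%R in s1 *; set V := (\sum_h _)%R in intM2 *.
have iM : P0.-integrable setT (EFin \o M).
  apply/integrableP; split; first exact/measurable_EFinP.
  under eq_integral do rewrite /= ger0_norm//.
  by rewrite intM// ltry.
have i1 : P0.-integrable setT (cst 1%:E).
  exact: finite_measure_integrable_cst.
(* Integrates $|y| \le e/2 + y^2/(2e)$ at $y = M - 1$. The term linear in [M] is moved to the left,
   so that both integrands are nonnegative. *)
have key : \int[P0]_x `|M x - 1|%:E <= (e / 2 + (V - 2 * s + 1) / (2 * e))%:E.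
  have m1 : measurable_fun [set: T] (fun x => `|M x - 1|%R).
    by apply: measurableT_comp => //; exact: measurable_funB.
  have : \int[P0]_x (`|M x - 1|%:E + (e^-1)%:E * (M x)%:E) <=
         \int[P0]_x ((e / 2 + (2 * e)^-1)%:E + ((2 * e)^-1)%:E * (M x ^+ 2)%:E).
    apply: ge0_le_integral => //.
    - by move=> x _; rewrite adde_ge0// ?lee_fin// mulr_ge0 ?invr_ge0// ltW.
    - by apply: emeasurable_funD; [exact/measurable_EFinP|apply: emeasurable_funM => //; exact/measurable_EFinP].
    - apply: emeasurable_funD => //; apply: emeasurable_funM => //; apply/measurable_EFinP.
      exact: measurable_funX.
    - move=> x _; rewrite -!EFinM -!EFinD lee_fin.
      have -> : (e / 2 + (2 * e)^-1 + (2 * e)^-1 * M x ^+ 2 =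
         `|M x - 1| + e^-1 * M x + (2 * e)^-1 * (e - `|M x - 1|) ^+ 2)%R.
        rewrite sqrrB real_normK ?num_real//.
        by field; rewrite gt_eqF.
      by rewrite lerDl mulr_ge0 ?sqr_ge0// invr_ge0 mulr_ge0// ltW.
  have e1 : (0 <= e^-1)%R by rewrite invr_ge0 ltW.
  have e2 : (0 <= (2 * e)^-1)%R by rewrite invr_ge0 mulr_ge0// ltW.
  have mM2 : measurable_fun [set: T] (fun x => (M x ^+ 2)%:E).
    by apply/measurable_EFinP; exact: measurable_funX.
  have mME : measurable_fun [set: T] (fun x => (M x)%:E) by exact/measurable_EFinP.
  have -> : \int[P0]_x (`|M x - 1|%:E + (e^-1)%:E * (M x)%:E) =
      \int[P0]_x `|M x - 1|%:E + (e^-1)%:E * s%:E.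
    rewrite -s1 -intM// -ge0_integralZl//; last by move=> x _; rewrite lee_fin.
    rewrite ge0_integralD//.
    - exact/measurable_EFinP.
    - by move=> x _; rewrite -EFinM lee_fin mulr_ge0.
    - by apply: emeasurable_funM.
  have -> : \int[P0]_x ((e / 2 + (2 * e)^-1)%:E + ((2 * e)^-1)%:E * (M x ^+ 2)%:E) =
      (e / 2 + (2 * e)^-1)%:E + ((2 * e)^-1)%:E * \int[P0]_x (M x ^+ 2)%:E.
    rewrite -ge0_integralZl//; last by move=> x _; rewrite lee_fin sqr_ge0.
    rewrite ge0_integralD//.
    - rewrite integral_cst//; congr (_ + _).
      by rewrite -[RHS]mule1; congr (_ * _); exact: probability_setT.
    - by move=> x _; rewrite lee_fin addr_ge0// divr_ge0// ltW.
    - by move=> x _; rewrite -EFinM lee_fin mulr_ge0// sqr_ge0.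
    - by apply: emeasurable_funM.
  move=> K; have : \int[P0]_x `|M x - 1|%:E + (e^-1)%:E * s%:E <=
      (e / 2 + (2 * e)^-1)%:E + ((2 * e)^-1)%:E * V%:E.
    by apply: (le_trans K); rewrite leeD2l// lee_wpmul2l// lee_fin.
  rewrite -!EFinM -EFinD -leeBrDr// -EFinB.
  move=> K2; apply: (le_trans K2); rewrite lee_fin le_eqVlt; apply/orP; left; apply/eqP.
  by field; rewrite gt_eqF.
rewrite -lee_fin; apply: le_trans key.
have iMA : P0.-integrable A (EFin \o M) by exact: integrableS iM.
have i1A : P0.-integrable A (cst 1%:E) by exact: integrableS i1.
have -> : (`|\sum_h c h * fine (nu h A) - fine (P0 A)|%R)%:E =
    `|\int[P0]_(x in A) ((M x)%:E - 1)|.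
  have -> : \int[P0]_(x in A) ((M x)%:E - 1) =
      \int[P0]_(x in A) (M x)%:E - \int[P0]_(x in A) cst 1 x.
    exact: (integralB mA iMA i1A).
  rewrite intM// integral_cst// mul1e.
  by rewrite -[X in _ - X](@fineK _ (P0 A)) ?fin_num_measure.
have mM1 : measurable_fun [set: T] (fun x => (M x)%:E - 1).
  by apply: emeasurable_funB => //; exact/measurable_EFinP.
apply: le_trans (le_abse_integral P0 mA _) _; first exact: measurable_funTS.
apply: (@ge0_subset_integral _ _ _ P0 A setT) => //=.
apply/measurable_EFinP; apply: measurableT_comp => //.
exact: measurable_funB.
Qed.

End second_moment.

(** * Likelihood ratios of matrices with independent entries *)

Section likelihood.
Context {R : realType}.
Local Notation RR := (measurableTypeR R).

Lemma lee_prod_EFin (I : finType) (a : I -> \bar R) (b : I -> R) :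
  (forall i, 0 <= a i <= (b i)%:E)%E -> (\prod_i a i <= (\prod_i b i)%:E)%E.
Proof.
move=> H; suff : (0 <= \prod_i a i <= (\prod_i b i)%:E)%E by case/andP.
apply: (big_rec2 (fun x y => 0 <= x <= y%:E)%E).
  by rewrite lee01 lexx.
move=> i x y _ /andP[y0 yx]; have /andP[a0 ab] := H i.
by rewrite mule_ge0//= EFinM lee_pmul.
Qed.

(** Pointwise $f f' + 1 = f + f' + (f-1)^2/2 + (f'-1)^2/2 - (f-f')^2/2$; dropping the last square
    separates [f] from [f'], so that each enters through its own chi-square divergence. Then $1 + z
    \le e^z$. *)
Lemma integral_density_mul_le (nu nu' mu : probability RR R) (f f' : RR -> R) (a a' : R) :
  is_density nu mu f -> is_density nu' mu f' ->
  (\int[mu]_x ((f x - 1) ^+ 2)%:E = a%:E)%E ->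
  (\int[mu]_x ((f' x - 1) ^+ 2)%:E = a'%:E)%E ->
  (\int[mu]_x (f x * f' x)%:E <= (expR ((a + a') / 2))%:E)%E.
Proof.
move=> df df' fa fa'.
have [mf f0 _] := df; have [mf' f0' _] := df'.
have f1 : (\int[mu]_x (f x)%:E = 1)%E.
  by rewrite -(is_density_set df measurableT); exact: probability_setT.
have f1' : (\int[mu]_x (f' x)%:E = 1)%E.
  by rewrite -(is_density_set df' measurableT); exact: probability_setT.
have msq (g : RR -> R) : measurable_fun setT g ->
    measurable_fun setT (fun x => (2^-1 * (g x - 1) ^+ 2)).
  by move=> mg; apply: measurable_funM => //; apply: measurable_funX; exact: measurable_funB.
have sq0 (g : RR -> R) x : 0 <= 2^-1 * (g x - 1) ^+ 2.
  by rewrite mulr_ge0 ?invr_ge0// sqr_ge0.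
have intsq (g : RR -> R) b : measurable_fun setT g ->
    (\int[mu]_x ((g x - 1) ^+ 2)%:E = b%:E)%E ->
    (\int[mu]_x (2^-1 * (g x - 1) ^+ 2)%:E = (2^-1 * b)%:E)%E.
  move=> mg gb; under eq_integral do rewrite EFinM.
  have m1 : measurable_fun setT (fun x : RR => ((g x - 1) ^+ 2)%:E).
    by apply/measurable_EFinP; apply: measurable_funX; exact: measurable_funB.
  rewrite ge0_integralZl//; first by rewrite gb -EFinM.
  by move=> x _; rewrite lee_fin sqr_ge0.
have intD (g h : RR -> R) : measurable_fun setT g -> measurable_fun setT h ->
   (forall x, 0 <= g x) -> (forall x, 0 <= h x) ->
   (\int[mu]_x (g x + h x)%:E = \int[mu]_x (g x)%:E + \int[mu]_x (h x)%:E)%E.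
  move=> mg mh g0 h0; under eq_integral do rewrite EFinD.
  by rewrite ge0_integralD//; [move=> x _; rewrite lee_fin|exact/measurable_EFinP|
    move=> x _; rewrite lee_fin|exact/measurable_EFinP].
have : (\int[mu]_x (f x * f' x + 1)%:E <=
  \int[mu]_x ((f x + f' x) + (2^-1 * (f x - 1) ^+ 2 + 2^-1 * (f' x - 1) ^+ 2))%:E)%E.
  apply: ge0_le_integral => //.
  - by move=> x _; rewrite lee_fin addr_ge0// mulr_ge0.
  - by apply/measurable_EFinP; apply: measurable_funD => //; exact: measurable_funM.
  - apply/measurable_EFinP; apply: measurable_funD; apply: measurable_funD => //; exact: msq.
  - move=> x _; rewrite lee_fin -subr_ge0.
    rewrite (_ : _ - _ = 2^-1 * (f x - f' x) ^+ 2); last by field.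
    by rewrite mulr_ge0 ?invr_ge0 ?sqr_ge0.
have -> : (\int[mu]_x (f x * f' x + 1)%:E =
    \int[mu]_x (f x * f' x)%:E + \int[mu]_x (1 : R)%:E)%E.
  apply: (intD (fun x => f x * f' x) (cst 1)) => //; first exact: measurable_funM.
  by move=> x; rewrite mulr_ge0.
have -> : (\int[mu]_x ((f x + f' x) +
    (2^-1 * (f x - 1) ^+ 2 + 2^-1 * (f' x - 1) ^+ 2))%:E =
    \int[mu]_x (f x)%:E + \int[mu]_x (f' x)%:E +
    (\int[mu]_x (2^-1 * (f x - 1) ^+ 2)%:E + \int[mu]_x (2^-1 * (f' x - 1) ^+ 2)%:E))%E.
  rewrite -(intD f f')// -intD; [|exact: msq|exact: msq|exact: sq0|exact: sq0].
  apply: (intD (fun x => f x + f' x)).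
  - exact: measurable_funD.
  - by apply: measurable_funD; exact: msq.
  - by move=> x; rewrite addr_ge0.
  - by move=> x; rewrite addr_ge0.
rewrite f1 f1' (intsq _ a)// (intsq _ a')//.
have -> : (\int[mu]_x (1 : R)%:E = 1)%E.
  by rewrite integral_cst// mul1e; exact: probability_setT.
rewrite -leeBrDr// => /le_trans; apply.
rewrite -!EFinD -?EFinB lee_fin; apply: le_trans (expR_ge1Dx _); lra.
Qed.

Definition matrix_density n (f : 'I_n * 'I_n -> RR -> R)
    (x : n.-tuple (n.-tuple RR)) : R :=
  \prod_(i < n) \prod_(j < n) f (i, j) (tnth (tnth x i) j).

Lemma is_density_matrix_law n (P' P : 'I_n * 'I_n -> probability RR R)
    (f : 'I_n * 'I_n -> RR -> R) :
  (forall c, is_density (P' c) (P c) (f c)) ->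
  is_density (matrix_law P') (matrix_law P) (matrix_density f).
Proof.
move=> H; apply: (@is_density_tuple_law _ _ _ n _ _
  (fun i y => \prod_(j < n) f (i, j) (tnth y j))) => i.
by apply: (@is_density_tuple_law _ _ _ n _ _ (fun j => f (i, j))) => j.
Qed.

Lemma integral_matrix_law_prod n (P : 'I_n * 'I_n -> probability RR R)
    (f : 'I_n * 'I_n -> RR -> R) :
  (forall c, measurable_fun setT (f c)) -> (forall c x, 0 <= f c x) ->
  (\int[matrix_law P]_x (matrix_density f x)%:E =
   \prod_(i < n) \prod_(j < n) \int[P (i, j)]_x (f (i, j) x)%:E)%E.
Proof.
move=> mf f0.
rewrite (integral_tuple_law_prod _
  (f := fun i y => \prod_(j < n) f (i, j) (tnth y j))); last 2 first.
- by move=> i; apply: (measurable_prod_tnth (f := fun j => f (i, j))).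
- by move=> i y; rewrite prodr_ge0.
by apply: eq_bigr => i _; rewrite (integral_tuple_law_prod _ (f := fun j => f (i, j))).
Qed.

Lemma matrix_density_mul n (f g : 'I_n * 'I_n -> RR -> R) x :
  matrix_density f x * matrix_density g x =
  matrix_density (fun c y => f c y * g c y) x.
Proof.
by rewrite /matrix_density -big_split; apply: eq_bigr => i _; rewrite -big_split.
Qed.

End likelihood.

(** * Placements and templates *)

Section template_model.
Context {R : realType} {n m k : nat}.
Local Notation RR := (measurableTypeR R).
Implicit Types (t : {ffun 'I_m -> block n}) (c : 'I_n * 'I_n) (bl : {set block n}).

(* The blocks of a placement listed in the order of their labels. *)
Definition ordered_placements bl : {set {ffun 'I_m -> block n}} :=
  [set t : {ffun 'I_m -> block n} | [forall l, t l \in bl] &&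
    [forall l, forall l', (l != l') ==> [disjoint cells (t l) & cells (t l')]]].

Lemma ordered_placementsP bl t : reflect
  ((forall l, t l \in bl) /\
   (forall l l', l != l' -> [disjoint cells (t l) & cells (t l')]%B))
  (t \in ordered_placements bl).
Proof.
rewrite inE; apply: (iffP andP) => [[/forallP H1 /forallP H2]|[H1 H2]]; split => //.
- by move=> l l' ll'; have /forallP/(_ l')/implyP := H2 l; apply.
- exact/forallP.
- by apply/forallP => l; apply/forallP => l'; apply/implyP; exact: H2.
Qed.

Definition covering t c : option 'I_m := [pick l | c \in cells (t l)].

Definition template_cell t c : option ('I_m * ('I_k * 'I_k)) :=
  if covering t c is Some l then omap (pair l) (block_coord k (t l) c) else None.

Lemma covering_eq bl t c l : t \in ordered_placements bl ->
  c \in cells (t l) -> covering t c = Some l.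
Proof.
move=> /ordered_placementsP[_ dt] cl; rewrite /covering.
case: pickP => [l' cl'|/(_ l)]; last by rewrite cl.
have [->//|ll'] := eqVneq l' l.
by have := disjointFr (dt _ _ ll') cl'; rewrite cl.
Qed.

Definition template_weight (x : 'I_m -> 'I_k * 'I_k -> R) t c : R :=
  if template_cell t c is Some lu then x lu.1 lu.2 else 0.

Lemma template_weight_ge0 x t c : (forall l u, 0 <= x l u) ->
  0 <= template_weight x t c.
Proof. by move=> x0; rewrite /template_weight; case: template_cell. Qed.

Variable P : 'I_m -> 'I_k * 'I_k -> probability RR R.

Definition template_law t c : probability RR R :=
  if template_cell t c is Some lu then P lu.1 lu.2 else std_normal.

Definition template_density t c : RR -> R :=
  if template_cell t c is Some lu then rn_density (P lu.1 lu.2) std_normal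
  else cst 1.

Section likelihood_ratio.
Hypothesis P_ac : forall l u, P l u `<< @std_normal R.

Lemma is_density_template t c :
  is_density (template_law t c) std_normal (template_density t c).
Proof.
rewrite /template_law /template_density; case: template_cell => [lu|].
  exact: is_density_rn.
exact: is_density_cst1.
Qed.

Lemma is_density_template_matrix t :
  is_density (matrix_law (template_law t)) (law_H0 n)
    (matrix_density (template_density t)).
Proof. by apply: is_density_matrix_law => c; exact: is_density_template. Qed.

Variable x : 'I_m -> 'I_k * 'I_k -> R.
Hypothesis xE : forall l u, chi2_div (P l u) std_normal = (x l u)%:E.

Definition overlap t t' : R :=
  \sum_c (isSome (template_cell t' c))%:R * template_weight x t c.

Lemma template_density_chi2 t c :
  (\int[std_normal]_y ((template_density t c y - 1) ^+ 2)%:E =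
   (template_weight x t c)%:E)%E.
Proof.
rewrite /template_density /template_weight; case: template_cell => [lu|].
  by rewrite -xE chi2_div_rn.
by under eq_integral do rewrite subrr expr0n /=; rewrite integral0.
Qed.

(** The integral factorises over cells. A cell missed by one of the placements contributes the
    integral of a density, that is 1; a cell covered by both contributes at most the exponential of
    half the sum of its two weights. Convexity of the exponential then separates the two
    overlaps. *)
Lemma template_second_moment t t' :
  (\int[law_H0 n]_y (matrix_density (template_density t) y *
     matrix_density (template_density t') y)%:E <=
   ((expR (overlap t t') + expR (overlap t' t)) / 2)%:E)%E.
Proof.
under eq_integral do rewrite matrix_density_mul.
have dd s c := is_density_template s c.
have md s c : measurable_fun setT (template_density s c) by have [] := dd s c.
have d0 s c y : 0 <= template_density s c y by have [_ + _] := dd s c.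
rewrite integral_matrix_law_prod; last 2 first.
- by move=> c; exact: measurable_funM.
- by move=> c y; rewrite mulr_ge0.
rewrite pair_bigA /=.
pose b c : R := (isSome (template_cell t' c))%:R * template_weight x t c.
pose b' c : R := (isSome (template_cell t c))%:R * template_weight x t' c.
apply: (@le_trans _ _ (\prod_c expR ((b c + b' c) / 2))%:E).
  apply: lee_prod_EFin => -[i j] /=; apply/andP; split.
    by apply: integral_ge0 => y _; rewrite lee_fin mulr_ge0.
  have intd s c : (\int[std_normal]_y (template_density s c y)%:E = 1)%E.
    by rewrite -(is_density_set (dd s c) measurableT); exact: probability_setT.
  case E : (template_cell t (i, j)) => [lu|]; last first.
    rewrite [template_density t _]/template_density E.
    under eq_integral do rewrite mul1r.
    rewrite intd lee_fin /b /b' /template_weight E mulr0 mul0r add0r mul0r.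
    by rewrite expR0.
  case E' : (template_cell t' (i, j)) => [lu'|]; last first.
    rewrite [template_density t' _]/template_density E'.
    under eq_integral do rewrite mulr1.
    rewrite intd lee_fin /b /b' /template_weight E' mulr0 mul0r add0r mul0r.
    by rewrite expR0.
  rewrite /b /b' E E' !mul1r.
  exact: (integral_density_mul_le (dd t (i, j)) (dd t' (i, j))
    (template_density_chi2 t (i, j)) (template_density_chi2 t' (i, j))).
rewrite lee_fin -expR_sum -mulr_suml big_split /= -/(overlap t t') -/(overlap t' t).
set a := overlap t t'; set a' := overlap t' t.
have -> : (expR a + expR a') / 2 =
    expR ((a + a') / 2) + 2^-1 * (expR (a / 2) - expR (a' / 2)) ^+ 2.
  have ea (z : R) : expR z = expR (z / 2) ^+ 2 by rewrite -expRM_natl; congr expR; field.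
  by rewrite (ea a) (ea a') [in expR ((a + a') / 2)]mulrDl expRD; field.
by rewrite lerDl mulr_ge0 ?invr_ge0// sqr_ge0.
Qed.

End likelihood_ratio.

Let dflt : block n := (finset.set0, finset.set0).

(** The inverse of [b]. The default [dflt] is never reached when [b] is bijective. *)
Definition tuple_of_labeling (K : {set block n}) (b : {ffun {B | B \in K} -> 'I_m}) :
    {ffun 'I_m -> block n} :=
  [ffun l => if [pick B | b B == l] is Some B then val B else dflt].

Lemma tuple_of_labelingE (K : {set block n}) (b : {ffun {B | B \in K} -> 'I_m}) B :
  injective b -> tuple_of_labeling b (b B) = val B.
Proof.
move=> binj; rewrite ffunE; case: pickP => [B' /eqP/binj->//|/(_ B)].
by rewrite eqxx.
Qed.

Lemma tuple_of_labeling_inj (K : {set block n}) :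
  {in labelings m K &, injective (@tuple_of_labeling K)}.
Proof.
move=> b b'; rewrite !inE => bb bb' E.
have binj := bij_inj bb; have binj' := bij_inj bb'; have [g gK Kg] := bb'.
apply/ffunP => B.
have := tuple_of_labelingE B binj; rewrite E -[b B]Kg tuple_of_labelingE//.
by move=> /val_inj ->.
Qed.

Variable bl : {set block n}.
Hypothesis bl_cells : forall B, B \in bl -> cells B != finset.set0.

(** A repeated block would be disjoint from itself, hence empty; [bl_cells] excludes this. *)
Lemma ordered_placements_inj t : t \in ordered_placements bl -> injective t.
Proof.
move=> /ordered_placementsP[tbl dt] l l' E; apply/eqP/negPn/negP => ll'.
have := dt _ _ ll'; rewrite E -setI_eq0 finset.setIid => /eqP c0.
by have := bl_cells (tbl l'); rewrite c0 eqxx.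
Qed.

Lemma tuple_of_labeling_imset (K : {set block n}) : K \in placements m bl ->
  [set tuple_of_labeling b | b in labelings m K]%SET =
  [set t in ordered_placements bl | t @: finset.setT == K]%SET.
Proof.
rewrite inE => /and3P[/eqP Km Kbl /forallP Kdisj].
apply/setP => t; apply/imsetP/idP.
- move=> [b]; rewrite inE => /asboolP bb ->.
  have binj := bij_inj bb; have [g gK Kg] := bb.
  have tE l : tuple_of_labeling b l = val (g l).
    by rewrite -[in LHS](Kg l) tuple_of_labelingE.
  rewrite inE; apply/andP; split.
    apply/ordered_placementsP; split => [l|l l' ll'].
      by rewrite tE (fintype.subsetP Kbl)// (valP (g l)).
    rewrite !tE; have /implyP/(_ (valP (g l)))/forallP/(_ (val (g l'))) := Kdisj (val (g l)).
    move=> /implyP/(_ (valP (g l')))/implyP; apply.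
    by apply: contra ll' => /eqP/val_inj/(can_inj Kg)->.
  apply/eqP/setP => B; apply/imsetP/idP => [[l _ ->]|BK].
    by rewrite tE (valP (g l)).
  by exists (b (exist _ B BK)); rewrite ?inE// tE gK.
- rewrite inE => /andP[tO /eqP tK].
  have tinj := ordered_placements_inj tO.
  have ex (B : {B | B \in K}) : exists l, t l == val B.
    have : val B \in t @: finset.setT by rewrite tK; exact: (valP B).
    by case/imsetP => l _ E; exists l; apply/eqP.
  have exK (B : {B | B \in K}) : t (xchoose (ex B)) = val B.
    exact/eqP/(xchooseP (ex B)).
  pose b := [ffun B : {B | B \in K} => xchoose (ex B)].
  have tKl l : t l \in K by rewrite -tK imset_f.
  have bb : bijective b.
    exists (fun l => exist _ (t l) (tKl l)) => [B|l].
      by apply: val_inj; rewrite /= ffunE exK.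
    by apply: tinj; rewrite ffunE exK.
  exists b; first by rewrite inE; apply/asboolP.
  apply/ffunP => l; have [g gK Kg] := bb.
  by rewrite -(Kg l) (tuple_of_labelingE _ (bij_inj bb)) ffunE exK.
Qed.

Lemma card_labelings (K : {set block n}) : #|K| = m -> #|labelings m K| = m`!.
Proof.
move=> Km; have KE : #|{: {B | B \in K}}| = m by rewrite card_sig Km.
have -> : labelings m K = [set b : {ffun {B | B \in K} -> 'I_m} | injectiveb b]%SET.
  apply/setP => b; rewrite !inE; apply/idP/injectiveP => [/asboolP/bij_inj//|binj]; apply/asboolP.
  by apply: inj_card_bij => //; rewrite KE card_ord.
by rewrite card_inj_ffuns KE card_ord ffactnn.
Qed.

(** A list of disjoint blocks carries the same information as its image, which is a placement,
    together with a labeling of that image. *)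
Lemma sum_ordered_placements (V : nmodType) (F : {ffun 'I_m -> block n} -> V) :
  \sum_(t in ordered_placements bl) F t =
  \sum_(K in placements m bl) \sum_(b in labelings m K) F (tuple_of_labeling b).
Proof.
rewrite (partition_big (fun t : {ffun 'I_m -> block n} => t @: finset.setT)
  (mem (placements m bl))) /=.
  apply: eq_bigr => K KF; rewrite -(big_imset F (@tuple_of_labeling_inj K)) /=.
  by rewrite tuple_of_labeling_imset//; apply: eq_bigl => t; rewrite [RHS]inE.
move=> t tO; have /ordered_placementsP[tbl dt] := tO; rewrite inE; apply/and3P; split.
- by rewrite card_imset ?cardsT ?card_ord//; exact: ordered_placements_inj.
- by apply/fintype.subsetP => _ /imsetP[l _ ->].
- apply/forallP => B; apply/implyP => /imsetP[l _ ->].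
  apply/forallP => B'; apply/implyP => /imsetP[l' _ ->]; apply/implyP => ll'.
  by apply: dt; apply: contra ll' => /eqP ->.
Qed.

Lemma card_ordered_placements :
  #|ordered_placements bl| = (#|placements m bl| * m`!)%N.
Proof.
rewrite -sum1_card (sum_ordered_placements (fun=> 1%N)).
rewrite (eq_bigr (fun=> m`!)) ?sum_nat_const// => K.
by rewrite inE => /andP[/eqP Km _]; rewrite sum1_card card_labelings.
Qed.

Lemma entry_law_tuple (K : {set block n}) (b : {ffun {B | B \in K} -> 'I_m}) c :
  K \in placements m bl -> b \in labelings m K ->
  entry_law P b c = template_law (tuple_of_labeling b) c.
Proof.
move=> KF bL.
have : tuple_of_labeling b \in [set t in ordered_placements bl | t @: finset.setT == K]%SET.
  by rewrite -tuple_of_labeling_imset// imset_f.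
rewrite inE => /andP[tO _].
move: bL; rewrite inE => /asboolP bb; have binj := bij_inj bb.
rewrite /entry_law /template_law /template_cell; case: pickP => [B cB|nB].
  rewrite (@covering_eq bl _ _ (b B)) ?tuple_of_labelingE//.
  by case: block_coord.
rewrite /covering; case: pickP => // l; have [g gK Kg] := bb.
by rewrite -(Kg l) tuple_of_labelingE// nB.
Qed.

(** Every placement has the same number [m]! of labelings, so choosing a placement and then a
    labeling uniformly amounts to a uniform choice of an ordered placement. *)
Lemma law_H1_ordered A :
  (law_H1 P (placements m bl) A =
   \sum_(t in ordered_placements bl)
     (#|ordered_placements bl|%:R^-1)%:E * matrix_law (template_law t) A)%E.
Proof.
rewrite sum_ordered_placements; apply: eq_bigr => K KF.
rewrite /= /uniform_mixture ge0_sume_distrr; last by move=> b _; rewrite mule_ge0.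
apply: eq_bigr => b bL; rewrite muleA -EFinM; congr (_%:E * _)%E.
  rewrite card_ordered_placements natrM invfM card_labelings//.
  by move: KF; rewrite inE => /andP[/eqP].
by congr (matrix_law _ A); apply/funext => c; exact: entry_law_tuple.
Qed.

End template_model.

(** * Comparison of the mixture with the null law *)

Section mixture.
Context {R : realType} {n m k : nat}.
Local Notation RR := (measurableTypeR R).
Local Notation tuples := {ffun 'I_m -> block n}.

(* The uniform law on [O] is that of [tup j h] with [j] uniform on [D] and [h]
   uniform on [H]; given [j], the second moment is taken over independent
   [h, h'], and the placements outside [G] are discarded. *)
Lemma mixture_close (P : 'I_m -> 'I_k * 'I_k -> probability RR R)
    (x : 'I_m -> 'I_k * 'I_k -> R) (O : {set tuples}) (J H : finType) (D : {set J})
    (tup : J -> H -> tuples) (G : pred tuples) (V s e : R) (A : set _) :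
  (forall l u, P l u `<< @std_normal R) ->
  (forall l u, chi2_div (P l u) std_normal = (x l u)%:E) ->
  (0 < #|O|)%N -> (0 < #|D|)%N -> (0 < #|H|)%N ->
  (forall F : tuples -> R, \sum_(j in D) \sum_h F (tup j h) / (#|D|%:R * #|H|%:R) =
     \sum_(t in O) F t / #|O|%:R) ->
  \sum_(j in D) \sum_h \sum_h' (G (tup j h))%:R *
     expR (overlap x (tup j h) (tup j h')) <= V * (#|D|%:R * #|H|%:R ^+ 2) ->
  0 < e -> measurable A ->
  s = (\sum_(t in O) (G t)%:R) / #|O|%:R ->
  `|\sum_(t in O) fine (matrix_law (template_law P t) A) / #|O|%:R
    - fine (law_H0 n A)| <= e / 2 + (V - 2 * s + 1) / (2 * e) + (1 - s).
Proof.
move=> P_ac xE O0 D0 H0 unif HV e0 mA sG.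
pose a t := fine (matrix_law (template_law P t) A); rewrite -/(law_H0 n).
set p := fine (law_H0 n A).
have a01 t : 0 <= a t <= 1.
  rewrite /a -!lee_fin fineK ?fin_num_measure//.
  by apply/andP; split; [exact: measure_ge0|exact: probability_le1].
have O0r : 0 < #|O|%:R :> R by rewrite ltr0n.
have D0r : 0 < #|D|%:R :> R by rewrite ltr0n.
have H0r : 0 < #|H|%:R :> R by rewrite ltr0n.
pose c j h : R := (G (tup j h))%:R / #|H|%:R.
pose E (t t' : tuples) := expR (overlap x t t').
pose B (t t' : tuples) := (E t t' + E t' t) / 2.
have bound j := @second_moment_bound _ _ R (law_H0 n) H
   (fun h => matrix_density (template_density P (tup j h)))
   (fun h => matrix_law (template_law P (tup j h))) (c j)
   (fun h h' => B (tup j h) (tup j h')) e A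
   (fun h => is_density_template_matrix P_ac (tup j h))
   (fun h => divr_ge0 (ler0n _ _) (ler0n _ _))
   (fun h h' => template_second_moment P_ac xE (tup j h) (tup j h')) e0 mA.
(* The placements outside [G] are split off; together they carry mass [1 - s]. *)
rewrite (_ : \sum_(t in O) _ = \sum_(t in O) ((G t)%:R * a t) / #|O|%:R +
     \sum_(t in O) ((~~ G t)%:R * a t) / #|O|%:R); last first.
  by rewrite -big_split; apply: eq_bigr => t _ /=; case: (G t); rewrite /a /=; ring.
set b := \sum_(t in O) ((~~ G t)%:R * a t) / #|O|%:R.
have b0 : 0 <= b.
  by apply: sumr_ge0 => t _; have /andP[? ?] := a01 t; rewrite divr_ge0// mulr_ge0.
have bs : b <= 1 - s.
  have -> : 1 - s = \sum_(t in O) (~~ G t)%:R / #|O|%:R.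
    have {1}-> : 1 = \sum_(t in O) (1 : R) / #|O|%:R.
      by rewrite -mulr_suml sumr_const divff// gt_eqF.
    rewrite sG mulr_suml -sumrB; apply: eq_bigr => t _.
    by case: (G t) => /=; ring.
  apply: ler_sum => t _; rewrite ler_wpM2r// ?invr_ge0// ler_piMr//.
  by have /andP[] := a01 t.
rewrite -(unif (fun t => (G t)%:R * a t)).
have sE : s = (\sum_(j in D) \sum_h c j h) / #|D|%:R.
  rewrite sG mulr_suml -(unif (fun t => (G t)%:R)) mulr_suml.
  apply: eq_bigr => j _; rewrite mulr_suml; apply: eq_bigr => h _.
  by rewrite /c invfM; ring.
rewrite addrAC; apply: le_trans (ler_normD _ _) _.
rewrite (ger0_norm b0); apply: lerD bs.
have -> : \sum_(j in D) \sum_h (G (tup j h))%:R * a (tup j h) / (#|D|%:R * #|H|%:R) - p =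
   \sum_(j in D) (\sum_h c j h * a (tup j h) - p) / #|D|%:R.
  rewrite -mulr_suml sumrB sumr_const mulrBl -[p *+ _]mulr_natr mulfK ?gt_eqF//.
  congr (_ - _); rewrite mulr_suml; apply: eq_bigr => j _.
  by rewrite mulr_suml; apply: eq_bigr => h _; rewrite /c invfM; ring.
apply: le_trans (ler_norm_sum _ _ _) _.
apply: (@le_trans _ _ (\sum_(j in D) (e / 2 + ((\sum_h \sum_h' c j h * c j h' *
   B (tup j h) (tup j h')) - 2 * \sum_h c j h + 1) / (2 * e)) / #|D|%:R)).
  apply: ler_sum => j _; rewrite normrM (ger0_norm (_ : 0 <= #|D|%:R^-1)) ?invr_ge0//.
  by rewrite ler_wpM2r ?invr_ge0//; exact: bound.
rewrite -mulr_suml big_split /= sumr_const mulrDl -[(e / 2) *+ _]mulr_natr mulfK ?gt_eqF//.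
rewrite lerD2l -mulr_suml mulrAC ler_wpM2r//; first by rewrite invr_ge0 mulr_ge0// ltW.
rewrite big_split sumrB /= sumr_const -[1 *+ _]mulr_natr mul1r mulrDl divff ?gt_eqF//.
rewrite lerD2r mulrBl -mulr_sumr -mulrA -sE lerD2r ler_pdivrMr//.
have HB j : \sum_h \sum_h' c j h * c j h' * B (tup j h) (tup j h') <=
   (\sum_h \sum_h' (G (tup j h))%:R * E (tup j h) (tup j h')) / #|H|%:R ^+ 2.
  have E0 t t' : 0 <= E t t' by exact: expR_ge0.
  (* Exchanging [h] and [h'] identifies the two halves of [B], so only one orientation of the
     overlap has to be controlled. *)
  have -> : \sum_h \sum_h' c j h * c j h' * B (tup j h) (tup j h') =
     \sum_h \sum_h' c j h * c j h' * E (tup j h) (tup j h').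
    transitivity ((\sum_h \sum_h' c j h * c j h' * E (tup j h) (tup j h') +
                   \sum_h \sum_h' c j h * c j h' * E (tup j h') (tup j h)) / 2).
      rewrite -big_split mulr_suml; apply: eq_bigr => h _ /=.
      rewrite -big_split mulr_suml; apply: eq_bigr => h' _ /=; rewrite /B; ring.
    rewrite [X in (_ + X) / 2]exchange_big /=.
    rewrite [X in (_ + X) / 2](_ : _ = \sum_h \sum_h' c j h * c j h' * E (tup j h) (tup j h')).
      by field.
    by apply: eq_bigr => h _; apply: eq_bigr => h' _; rewrite (mulrC (c j h')).
  rewrite mulr_suml; apply: ler_sum => h _; rewrite mulr_suml; apply: ler_sum => h' _.
  have -> : c j h * c j h' * E (tup j h) (tup j h') =
      (G (tup j h))%:R * E (tup j h) (tup j h') / #|H|%:R ^+ 2 * (G (tup j h'))%:R.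
    by rewrite /c; field; rewrite gt_eqF.
  by rewrite ler_piMr ?divr_ge0 ?mulr_ge0 ?exprn_ge0// lern1 leq_b1.
apply: le_trans (ler_sum _ (fun j _ => HB j)) _.
by rewrite -mulr_suml ler_pdivrMr ?exprn_gt0// -mulrA.
Qed.

End mixture.

(** * Consequences of a bound on [Theta_star] *)

Section theta.
Context {R : realType}.

Lemma bernoulli_ge (z : R) M : 0 <= z -> 1 + M%:R * (z - 1) <= z ^+ M.
Proof.
move=> z0; elim: M => [|M IH]; first by rewrite expr0 mul0r addr0.
rewrite exprS; apply: le_trans (ler_wpM2l z0 IH).
rewrite -subr_ge0 (_ : _ - _ = M%:R * (z - 1) ^+ 2); last by rewrite -natr1; ring.
by rewrite mulr_ge0// sqr_ge0.
Qed.

Context {m k : nat}.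
Hypotheses (m0 : (0 < m)%N) (k0 : (0 < k)%N).
Local Notation RR := (measurableTypeR R).

(** A single infinite divergence would make the average of exponentials infinite, so a real bound on
    [Theta_star] makes all divergences real. Exponentiating the bound for each label gives the last
    clause, the form in which the hypothesis is used from here on. *)
Lemma Theta_star_chi2 (P : 'I_m -> 'I_k * 'I_k -> probability RR R) (th : R) :
  (forall l u, P l u `<< @std_normal R) -> (Theta_star P <= th%:E)%E ->
  exists x : 'I_m -> 'I_k * 'I_k -> R,
   [/\ forall l u, 0 <= x l u,
       forall l u, chi2_div (P l u) std_normal = (x l u)%:E &
       forall l, \sum_u expR ((m ^ 2 * k ^ 2)%:R * x l u) <=
                 (k ^ 2)%:R * expR ((m ^ 2 * k ^ 2)%:R * th)].
Proof.
move=> P_ac HT; set p := (m ^ 2 * k ^ 2)%N in HT *.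
have p0 : (0 < p)%N by rewrite muln_gt0 !expn_gt0 m0 k0.
have p0r : 0 < p%:R :> R by rewrite ltr0n.
have k20 : 0 < (k ^ 2)%:R :> R by rewrite ltr0n expn_gt0 k0.
have chi0 l u : (0 <= chi2_div (P l u) std_normal)%E.
  rewrite chi2_div_rn//; apply: integral_ge0 => y _; rewrite lee_fin.
  exact: sqr_ge0.
have Hl l : ((p%:R^-1)%:E * lne (((k ^ 2)%:R^-1)%:E *
    \sum_(u : 'I_k * 'I_k) expeR (p%:R%:E * chi2_div (P l u) std_normal)) <= th%:E)%E.
  by apply: le_trans HT; rewrite /Theta_star; exact: le_bigmax.
have sumfin l : (\sum_(u : 'I_k * 'I_k) expeR (p%:R%:E * chi2_div (P l u) std_normal) <=
     ((k ^ 2)%:R * expR (p%:R * th))%:E)%E.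
  have := Hl l; set S := (\sum_(u : _) _)%E.
  have S0 : (0 <= S)%E by apply: sume_ge0 => u _; exact: expeR_ge0.
  case: S S0 => [s| |]// s0; last first.
    by rewrite gt0_muley ?lte_fin ?invr_gt0//= gt0_muley ?lte_fin ?invr_gt0.
  rewrite lee_fin in s0; rewrite -EFinM /=; case: ifPn => [sk0 _|].
    rewrite lee_fin; apply: (@le_trans _ _ 0).
      by move: sk0; rewrite pmulr_rle0// invr_gt0.
    by rewrite mulr_ge0// expR_ge0.
  rewrite -ltNge => sk0; rewrite -EFinM !lee_fin -ler_pdivlMl ?invr_gt0// invrK.
  by move=> H; rewrite -ler_pdivrMl// -(lnK sk0) ler_expR.
have chifin l u : chi2_div (P l u) std_normal \is a fin_num.
  rewrite ge0_fin_numE// ltNge leye_eq; apply/negP => /eqP chiy.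
  have := sumfin l; rewrite (bigD1 u)//= chiy gt0_muley ?lte_fin//=.
  rewrite addye; first by rewrite leye_eq.
  by apply/eqP => H; have : (0 <= -oo :> \bar R)%E by rewrite -[X in (_ <= X)%E]H;
    apply: sume_ge0 => v _; exact: expeR_ge0.
exists (fun l u => fine (chi2_div (P l u) std_normal)); split.
- by move=> l u; rewrite fine_ge0.
- by move=> l u; rewrite fineK.
- move=> l; rewrite -lee_fin; apply: le_trans (sumfin l).
  rewrite -sumEFin; apply: lee_sum => u _.
  by rewrite -[X in expeR (_ * X)](fineK (chifin l u)).
Qed.

Variables (x : 'I_k * 'I_k -> R) (th : R).
Hypothesis x0 : forall u, 0 <= x u.
Hypothesis hx : \sum_u expR ((m ^ 2 * k ^ 2)%:R * x u) <=
                 (k ^ 2)%:R * expR ((m ^ 2 * k ^ 2)%:R * th).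

Let cardk2 : #|{: 'I_k * 'I_k}| = (k ^ 2)%N.
Proof. by rewrite card_prod card_ord mulnn. Qed.

(** Jensen's inequality, through the tangent line of the exponential at [p * th]. *)
Lemma sum_chi2_le : \sum_u x u <= (k ^ 2)%:R * th.
Proof.
move: hx; set p : R := (m ^ 2 * k ^ 2)%:R => hx'; have p0 : 0 < p by rewrite ltr0n muln_gt0 !expn_gt0 m0 k0.
have : \sum_u (expR (p * th) * (1 + p * (x u - th))) <= (k ^ 2)%:R * expR (p * th).
  apply: le_trans hx'; apply: ler_sum => u _.
  rewrite (_ : p * x u = p * th + p * (x u - th)); last by ring.
  by rewrite expRD ler_wpM2l ?expR_ge0// expR_ge1Dx.
rewrite -mulr_sumr mulrC ler_pM2r ?expR_gt0// big_split /= sumr_const cardk2.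
rewrite gerDl -mulr_sumr pmulr_rle0// sumrB sumr_const cardk2 subr_le0.
by rewrite mulr_natl.
Qed.

(** One exponential is at most the whole sum. The logarithm of the factor [k ^ 2] is at most
    [2 * k], and dividing by $p = m^2 k^2$ leaves at most [2 / k]. *)
Lemma chi2_le u : x u <= th + 2 / k%:R.
Proof.
have k0r : 0 < k%:R :> R by rewrite ltr0n.
have m1 : 1 <= m%:R ^+ 2 :> R by rewrite -natrX ler1n expn_gt0 m0.
move: hx; set p : R := (m ^ 2 * k ^ 2)%:R => hx'; have p0 : 0 < p by rewrite ltr0n muln_gt0 !expn_gt0 m0 k0.
have pE : p = m%:R ^+ 2 * k%:R ^+ 2 by rewrite /p natrM !natrX.
have : expR (p * x u) <= expR (2 * k%:R + p * th).
  apply: (@le_trans _ _ (\sum_u expR (p * x u))).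
    by rewrite (bigD1 u)//= lerDl sumr_ge0// => v _; exact: expR_ge0.
  apply: le_trans hx' _; rewrite expRD ler_wpM2r ?expR_ge0//.
  rewrite natrX -[2%:R * _]/(2 * k%:R) expRM_natl lerXn2r ?nnegrE ?expR_ge0//.
  by apply: le_trans (expR_ge1Dx _); rewrite lerDr.
rewrite ler_expR -ler_pdivlMl// mulrDr mulKf ?gt_eqF// addrC => /le_trans; apply.
rewrite lerD2l ler_pdivrMl// pE.
have -> : m%:R ^+ 2 * k%:R ^+ 2 * (2 / k%:R) = m%:R ^+ 2 * (2 * k%:R) :> R.
  by field; rewrite gt_eqF.
by rewrite ler_peMl// mulr_ge0.
Qed.

(** Power mean inequality of exponent [m ^ 2], obtained by applying [bernoulli_ge] to each term
    divided by [w]. *)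
Lemma sum_expR_chi2_le : \sum_u expR ((k ^ 2)%:R * x u) <= (k ^ 2)%:R * expR ((k ^ 2)%:R * th).
Proof.
have k20 : 0 < (k ^ 2)%:R :> R by rewrite ltr0n expn_gt0 k0.
have M0 : 0 < (m ^ 2)%:R :> R by rewrite ltr0n expn_gt0 m0.
set w := expR ((k ^ 2)%:R * th); have w0 : 0 < w by exact: expR_gt0.
have pE y : expR ((m ^ 2 * k ^ 2)%:R * y) = expR ((k ^ 2)%:R * y) ^+ (m ^ 2) :> R.
  by rewrite -expRM_natl natrM mulrA.
move: hx; rewrite pE -/w; under eq_bigr do rewrite pE.
move=> h.
have : \sum_u w ^+ (m ^ 2) * (1 + (m ^ 2)%:R * (expR ((k ^ 2)%:R * x u) / w - 1)) <=
    (k ^ 2)%:R * w ^+ (m ^ 2).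
  apply: le_trans h; apply: ler_sum => u _.
  rewrite -[X in _ <= X ^+ _](mulfVK (lt0r_neq0 w0)) exprMn mulrC ler_wpM2r ?exprn_ge0 ?(ltW w0)//.
  by apply: bernoulli_ge; rewrite divr_ge0 ?expR_ge0// ltW.
rewrite -mulr_sumr mulrC ler_pM2r ?exprn_gt0// big_split /= sumr_const cardk2.
rewrite gerDl -mulr_sumr pmulr_rle0// sumrB sumr_const cardk2 subr_le0.
by rewrite -mulr_suml ler_pdivrMr.
Qed.

End theta.

(** * Random permutations *)

Section random_permutation.
Context {R : realType}.

(** Each induction step costs $(1 + 1/n)^a \le e$, as $a \le n$. *)
Lemma expn_le_ffact n a : (a <= n)%N ->
  n%:R ^+ a <= expR 1 ^+ a * (n ^_ a)%:R :> R.
Proof.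
elim: n a => [|n IH] [|a] //; rewrite ?expr0 ?ffactn0 ?mulr1//.
rewrite ltnS => an; rewrite ffactSS natrM !exprS.
rewrite [leRHS](_ : _ = n.+1%:R * (expR 1 * (expR 1 ^+ a * (n ^_ a)%:R))); last by ring.
rewrite ler_wpM2l//.
apply: (@le_trans _ _ (expR 1 * n%:R ^+ a)); last by rewrite ler_wpM2l ?expR_ge0// IH.
have [n0|n0] := posnP n.
  have -> : a = 0%N by apply/eqP; rewrite -leqn0 -n0.
  rewrite !expr0 mulr1.
  by apply: le_trans (expR_ge1Dx _); rewrite lerDl.
have n0r : 0 < n%:R :> R by rewrite ltr0n.
have -> : n.+1%:R = n%:R * (1 + n%:R^-1) :> R by rewrite mulrDr mulr1 divff ?gt_eqF// natr1.
rewrite exprMn mulrC ler_wpM2r ?exprn_ge0//.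
apply: (@le_trans _ _ (expR n%:R^-1 ^+ a)).
  by rewrite lerXn2r ?nnegrE ?expR_ge0 ?addr_ge0 ?invr_ge0// expR_ge1Dx.
by rewrite -expRM_natl ler_expR ler_pdivrMr// mul1r ler_nat.
Qed.

Variable n : nat.
Variable y : 'I_n -> 'I_n -> R.
Hypothesis y0 : forall j j', 0 <= y j j'.

(** Permutations are grouped by their restriction to [A]. Those with a given restriction lie in one
    coset of the permutations fixing [A] pointwise, so there are at most [(n - #|A|)]! of them, and
    none when the restriction is not injective. *)
Lemma sum_perm_prod_le (A : {set 'I_n}) :
  \sum_(t : 'S_n) \prod_(j in A) y j (t j) <=
  (n - #|A|)`!%:R * \prod_(j in A) \sum_j' y j j'.
Proof.
(* The restriction of [t] to [A], extended by the identity to be a function on all of ['I_n]. *)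
pose h (t : 'S_n) : {ffun 'I_n -> 'I_n} := [ffun j => if j \in A then t j else j].
pose Q (j : 'I_n) : pred 'I_n := if j \in A then predT else pred1 j.
have hQ t : h t \in family Q.
  by apply/familyP => j; rewrite ffunE /Q; case: ifP => _; rewrite inE.
rewrite (partition_big h (mem (family Q)))//=.
have -> : \prod_(j in A) \sum_j' y j j' = \sum_(f in family Q) \prod_(j in A) y j (f j).
  rewrite big_mkcond /=.
  rewrite (eq_bigr (fun j => \sum_(j' | Q j j') if j \in A then y j j' else 1)); last first.
    by move=> j _; rewrite /Q; case: ifP => // _; rewrite big_pred1_eq.
  rewrite bigA_distr_big_dep; apply: eq_bigr => f _.
  by rewrite [RHS]big_mkcond.
rewrite mulr_sumr; apply: ler_sum => f fQ.
have -> : \sum_(t | h t == f) \prod_(j in A) y j (t j) =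
    \sum_(t | h t == f) \prod_(j in A) y j (f j).
  by apply: eq_bigr => t /eqP <-; apply: eq_bigr => j jA; rewrite ffunE jA.
rewrite sumr_const -[leLHS]mulr_natl ler_wpM2r ?prodr_ge0// ler_nat.
have [t0 /eqP ht0|none] := pickP (fun t => h t == f); last first.
  by rewrite eq_card0// => t; rewrite [in LHS]inE none.
have -> : (n - #|A|)%N = #|(~: A)%SET| by rewrite [RHS]cardsCs finset.setCK card_ord.
rewrite -card_perm -(card_imset _ (mulIg t0^-1%g)).
apply: subset_leq_card; apply/fintype.subsetP => _ /imsetP[t ht ->].
rewrite unfold_in; apply/fintype.subsetP => j; rewrite inE permM !inE.
apply: contra => jA; apply/eqP/(@perm_inj _ t0); rewrite permKV.
have : h t = h t0 by rewrite ht0; apply/eqP; exact: ht.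
move=> /(congr1 (fun g : {ffun _ -> _} => g j)).
by rewrite !ffunE jA.
Qed.

(** Expand the product over subsets [A]. Since $(n-|A|)! \le n!\,(e/n)^{|A|}$, the bound on each
    term is multiplicative over [A], and the sum folds back into a product. *)
Lemma sum_perm_prod1_le :
  \sum_(t : 'S_n) \prod_j (1 + y j (t j)) <=
  n`!%:R * expR (expR 1 / n%:R * \sum_j \sum_j' y j j').
Proof.
pose Y j := \sum_j' y j j'.
have Y0 j : 0 <= Y j by apply: sumr_ge0.
have e0 : 0 <= expR 1 / n%:R :> R by rewrite divr_ge0 ?expR_ge0.
apply: (@le_trans _ _ (n`!%:R * \prod_j (1 + expR 1 / n%:R * Y j))); last first.
  rewrite ler_wpM2l// mulr_sumr expR_sum; apply: ler_prod => j _.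
  by rewrite addr_ge0 ?mulr_ge0//= expR_ge1Dx.
have expand (z : 'I_n -> R) : \prod_j (1 + z j) = \sum_(A : {set 'I_n}) \prod_(j in A) z j.
  under eq_bigr do rewrite addrC.
  by rewrite bigA_distr; apply: eq_bigr => A _; rewrite [RHS]big_mkcond.
rewrite (eq_bigr _ (fun (t : 'S_n) _ => expand (fun j => y j (t j)))) /=.
rewrite expand exchange_big /= mulr_sumr; apply: ler_sum => A _.
apply: le_trans (sum_perm_prod_le A) _.
rewrite big_split /= prodr_const mulrA ler_wpM2r//; first by apply: prodr_ge0 => j _; exact: Y0.
have An : (#|A| <= n)%N by rewrite -[X in (_ <= X)%N](card_ord n) max_card.
have [n00|n00] := posnP n.
  have -> : #|A| = 0%N by apply/eqP; rewrite -leqn0 -[X in (_ <= X)%N]n00.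
  by rewrite subn0 expr0 mulr1.
have n0r : 0 < n%:R :> R by rewrite ltr0n.
rewrite expr_div_n mulrA ler_pdivlMr ?exprn_gt0//.
rewrite -(ffact_fact An) natrM.
rewrite [leRHS](_ : _ = (n - #|A|)`!%:R * (expR 1 ^+ #|A| * (n ^_ #|A|)%:R)); last by ring.
by rewrite ler_wpM2l// expn_le_ffact.
Qed.

End random_permutation.

(** * Independent row and column permutations *)

Section random_row_column_permutation.
Context {R : realType}.

Lemma expR_sub1_le (w a : R) : 0 <= w -> w <= a -> expR w - 1 <= w * expR a.
Proof.
move=> w0 wa; apply: (@le_trans _ _ (w * expR w)); last first.
  by rewrite ler_wpM2l// ler_expR.
have : (1 - w) * expR w <= 1.
  rewrite -[leRHS](expRxMexpNx_1 w) mulrC ler_wpM2l ?expR_ge0//.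
  by apply: le_trans (expR_ge1Dx _).
lra.
Qed.

Variables (n m k : nat) (M : 'I_n -> 'I_n -> bool) (x : 'I_n -> 'I_n -> R).
Variables (r c : 'I_n -> nat) (C1 C3 th : R).
Hypotheses (k0 : (0 < k)%N) (n0 : (0 < n)%N) (mkn : (m * k <= n)%N).
Hypotheses (x0 : forall i j, 0 <= x i j) (x3 : forall i j, x i j <= 3 / k%:R * (M i j)%:R).
Hypotheses (Mr : forall i, (\sum_j M i j <= k * r i)%N)
           (Mc : forall j, (\sum_i M i j <= k * c j)%N).
Hypothesis C10 : 0 <= C1.
Hypothesis hc : \sum_j (c j)%:R * expR (3 * (c j)%:R) <= C1 * (m * k)%:R.
Hypothesis hr : \sum_i (\sum_j x i j) * expR (3 * expR 1 * C1 * (r i)%:R) <=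
                C3 * (m%:R * k%:R ^+ 2 * th).

Let k0r : 0 < k%:R :> R. Proof. by rewrite ltr0n. Qed.
Let n0r : 0 < n%:R :> R. Proof. by rewrite ltr0n. Qed.
Let e0 : 0 <= expR 1 :> R. Proof. exact: expR_ge0. Qed.
Let X i := \sum_j x i j.
(** Covered cells of a row, each weighted by the exponential of 3 times the degree of its column:
    the factor by which [X i] is multiplied once columns have been averaged. *)
Let Rw i' : R := \sum_j' expR (3 * (c j')%:R) * (M i' j')%:R.

Let X0 i : 0 <= X i. Proof. exact: sumr_ge0. Qed.
Let Rw0 i : 0 <= Rw i.
Proof. by apply: sumr_ge0 => j _; rewrite mulr_ge0// expR_ge0. Qed.

Let X_le i : X i <= 3 * (r i)%:R.
Proof.
apply: (@le_trans _ _ (3 / k%:R * \sum_j (M i j)%:R)).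
  by rewrite mulr_sumr; apply: ler_sum.
rewrite -natr_sum -mulrA ler_wpM2l// ler_pdivrMl// -natrM ler_nat.
exact: Mr.
Qed.

Let M_deg i j : (M i j)%:R <= (c j)%:R :> R.
Proof.
case Mij : (M i j) => //; rewrite ler_nat; have := Mc j.
rewrite (bigD1 i)//= Mij; case: (c j) => [|c']//; rewrite muln0; lia.
Qed.

(** A crude bound uniform in the row; through $mk \le n$ it offsets the factor $1/n$ coming from the
    average over column permutations. *)
Let Rw_le i : Rw i <= C1 * n%:R.
Proof.
apply: (@le_trans _ _ (C1 * (m * k)%:R)); last by rewrite ler_wpM2l// ler_nat.
apply: le_trans hc; apply: ler_sum => j _.
by rewrite mulrC ler_wpM2r// expR_ge0.
Qed.

Let sumRw : \sum_i Rw i <= C1 * (m%:R * k%:R ^+ 2).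
Proof.
rewrite /Rw exchange_big /=.
apply: (@le_trans _ _ (k%:R * \sum_j (c j)%:R * expR (3 * (c j)%:R))).
  rewrite mulr_sumr; apply: ler_sum => j _; rewrite -mulr_sumr mulrA mulrC.
  by rewrite ler_wpM2r ?expR_ge0// -natr_sum -natrM ler_nat.
have -> : C1 * (m%:R * k%:R ^+ 2) = k%:R * (C1 * (m * k)%:R) by rewrite natrM; ring.
by rewrite ler_wpM2l.
Qed.

(** For fixed rows, the exponent is a sum over columns of [w j (t j)], to which [sum_perm_prod1_le]
    applies. A column of degree [c j'] has at most [k * c j'] covered cells, so [w j j'] is at most
    [3 * c j'] and [expR w - 1] is at most [w] times a factor of the column alone. *)
Let inner (s : 'S_n) :
  \sum_(t : 'S_n) expR (\sum_i \sum_j x i j * (M (s i) (t j))%:R) <=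
  n`!%:R * expR (\sum_i expR 1 / n%:R * (X i * Rw (s i))).
Proof.
pose w j j' := \sum_i x i j * (M (s i) j')%:R.
have w0 j j' : 0 <= w j j' by apply: sumr_ge0 => i _; rewrite mulr_ge0.
have w3 j j' : w j j' <= 3 * (c j')%:R.
  apply: (@le_trans _ _ (3 / k%:R * \sum_i (M (s i) j')%:R)).
    rewrite mulr_sumr; apply: ler_sum => i _; rewrite ler_wpM2r//.
    apply: le_trans (x3 i j) _; rewrite ler_piMr ?divr_ge0//.
    by rewrite lern1 leq_b1.
  rewrite -natr_sum -mulrA ler_wpM2l// ler_pdivrMl// -natrM ler_nat.
  by apply: leq_trans (Mc j'); rewrite [leqRHS](reindex_inj (@perm_inj _ s)).
pose y j j' := expR (w j j') - 1.
have y0 j j' : 0 <= y j j' by rewrite subr_ge0 -expR0 ler_expR.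
apply: le_trans (_ : _ <= \sum_(t : 'S_n) \prod_j (1 + y j (t j))) _.
  apply: ler_sum => t _; rewrite exchange_big expR_sum le_eqVlt; apply/orP; left.
  by apply/eqP; apply: eq_bigr => j _; rewrite /y addrCA subrr addr0.
apply: le_trans (sum_perm_prod1_le y0) _; rewrite ler_wpM2l// ler_expR.
rewrite -mulr_sumr ler_wpM2l ?divr_ge0//.
apply: (@le_trans _ _ (\sum_j \sum_j' w j j' * expR (3 * (c j')%:R))).
  by apply: ler_sum => j _; apply: ler_sum => j' _; exact: expR_sub1_le.
rewrite le_eqVlt; apply/orP; left; apply/eqP.
rewrite exchange_big /=.
transitivity (\sum_j' \sum_i X i * (expR (3 * (c j')%:R) * (M (s i) j')%:R)).
  apply: eq_bigr => j' _; rewrite -mulr_suml exchange_big mulr_suml.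
  by apply: eq_bigr => i _; rewrite -mulr_suml /X; ring.
by rewrite exchange_big; apply: eq_bigr => i _; rewrite -mulr_sumr.
Qed.

Lemma sum_perm2_expR_le :
  \sum_(s : 'S_n) \sum_(t : 'S_n) expR (\sum_i \sum_j x i j * (M (s i) (t j))%:R) <=
  n`!%:R ^+ 2 * expR (expR 1 ^+ 2 * C1 * C3 *
                      (m%:R ^+ 2 * k%:R ^+ 4 * th / n%:R ^+ 2)).
Proof.
apply: le_trans (ler_sum _ (fun s _ => inner s)) _.
rewrite -mulr_sumr expr2 -mulrA ler_wpM2l//.
pose v i i' := expR 1 / n%:R * (X i * Rw i').
have en : 0 <= expR 1 / n%:R :> R by rewrite divr_ge0.
have v0 i i' : 0 <= v i i' by rewrite /v !mulr_ge0// invr_ge0.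
(* This bound dictates the exponent in [hr]: the moment required of row degrees depends on [C1],
   hence on the truncation of the columns. *)
have v3 i i' : v i i' <= 3 * expR 1 * C1 * (r i)%:R.
  apply: (@le_trans _ _ (expR 1 / n%:R * (3 * (r i)%:R * (C1 * n%:R)))).
    by rewrite ler_wpM2l// ler_pM.
  by rewrite le_eqVlt; apply/orP; left; apply/eqP; field; rewrite gt_eqF.
pose z i i' := expR (v i i') - 1.
have z0 i i' : 0 <= z i i' by rewrite subr_ge0 -expR0 ler_expR.
apply: le_trans (_ : _ <= \sum_(s : 'S_n) \prod_i (1 + z i (s i))) _.
  apply: ler_sum => s _; rewrite expR_sum le_eqVlt; apply/orP; left.
  by apply/eqP; apply: eq_bigr => i _; rewrite /z addrCA subrr addr0.
apply: le_trans (sum_perm_prod1_le z0) _; rewrite ler_wpM2l// ler_expR.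
apply: (@le_trans _ _ (expR 1 / n%:R * (expR 1 / n%:R *
   ((\sum_i X i * expR (3 * expR 1 * C1 * (r i)%:R)) * \sum_i' Rw i')))).
  rewrite ler_wpM2l// mulr_suml mulr_sumr; apply: ler_sum => i _.
  rewrite mulr_sumr mulr_sumr; apply: ler_sum => i' _.
  apply: le_trans (expR_sub1_le (v0 i i') (v3 i i')) _.
  by rewrite /v le_eqVlt; apply/orP; left; apply/eqP; ring.
apply: (@le_trans _ _ (expR 1 / n%:R * (expR 1 / n%:R *
   ((C3 * (m%:R * k%:R ^+ 2 * th)) * (C1 * (m%:R * k%:R ^+ 2)))))).
  do 2 rewrite ler_wpM2l//; rewrite ler_pM ?sumr_ge0// => i _.
  by rewrite mulr_ge0// expR_ge0.
by rewrite le_eqVlt; apply/orP; left; apply/eqP; field; rewrite gt_eqF.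
Qed.

End random_row_column_permutation.

(** * Degrees of uniform placements *)

Section column_degrees.
Context {n m k : nat}.
Implicit Types (t : {ffun 'I_m -> block n}) (j : 'I_n) (l : 'I_m).
Local Notation O := (ordered_placements (blocks n k)).

Definition col_blocks t j : {set 'I_m} := [set l | j \in (t l).2]%SET.
Definition col_deg t j := #|col_blocks t j|.
Definition num_deg a t : nat := \sum_j (col_deg t j == a).

Lemma disjoint_cells (B B' : block n) :
  ([disjoint cells B & cells B'] = [disjoint B.1 & B'.1] || [disjoint B.2 & B'.2])%B.
Proof.
apply/idP/orP => [|[] H].
- move=> H; apply/orP/negPn; rewrite negb_or -!setI_eq0.
  apply/negP => /andP[/set0Pn[i +] /set0Pn[j +]]; rewrite !finset.in_setI => /andP[i1 i2] /andP[j1 j2].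
  have ij : (i, j) \in cells B by rewrite finset.in_setX i1.
  by have := disjointFr H ij; rewrite finset.in_setX i2 j2.
- rewrite -setI_eq0; apply/eqP/setP => -[i j]; rewrite finset.in_setI !finset.in_setX finset.in_set0.
  by apply/negP => /andP[/andP[i1 _] /andP[i2 _]]; have := disjointFr H i1; rewrite i2.
- rewrite -setI_eq0; apply/eqP/setP => -[i j]; rewrite finset.in_setI !finset.in_setX finset.in_set0.
  by apply/negP => /andP[/andP[_ i1] /andP[_ i2]]; have := disjointFr H i1; rewrite i2.
Qed.

Lemma nc_placementsP t : reflect
  ((forall l, #|(t l).1| = k /\ #|(t l).2| = k) /\
   (forall l l', l != l' ->
      [disjoint (t l).1 & (t l').1]%B \/ [disjoint (t l).2 & (t l').2]%B))
  (t \in O).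
Proof.
apply: (iffP (ordered_placementsP _ _)) => -[H1 H2]; split.
- by move=> l; have := H1 l; rewrite inE => /andP[/eqP -> /eqP ->].
- by move=> l l' /H2; rewrite disjoint_cells => /orP.
- by move=> l; rewrite inE; have [-> ->] := H1 l; rewrite !eqxx.
- by move=> l l' /H2 /orP; rewrite -disjoint_cells.
Qed.

Lemma sum_col_deg t : t \in O -> (\sum_j col_deg t j = m * k)%N.
Proof.
move=> /nc_placementsP[tk _].
under eq_bigr do rewrite /col_deg -sum1_card big_mkcond /=.
rewrite exchange_big /= (eq_bigr (fun=> k)) ?sum_nat_const ?card_ord//.
move=> l _; have [_ <-] := tk l; rewrite -sum1_card [RHS]big_mkcond /=.
by apply: eq_bigr => j _; rewrite inE.
Qed.

Hypothesis mkn : (m * k <= n)%N.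

(** The mean degree is at most 1. Sum over columns the inequality $1 + [d = a] \le d + [d = 0]$,
    valid for every degree $d$ as $a \ge 2$. *)
Lemma num_deg_le0 a t : t \in O -> (1 < a)%N -> (num_deg a t <= num_deg 0 t)%N.
Proof.
move=> tO a1; rewrite -(leq_add2l n).
have H : (\sum_(j < n) (1 + (col_deg t j == a)) <=
         \sum_(j < n) (col_deg t j + (col_deg t j == 0)))%N.
  apply: leq_sum => j _; case: (col_deg t j) => [|[|d]] /=.
  - by case: a a1.
  - by case: a a1 => [|[|a]].
  - by case: eqP; lia.
move: H; rewrite !big_split /= sum_col_deg// sum1_card card_ord -/(num_deg a t) -/(num_deg 0 t).
by move=> H; apply: leq_trans H _; rewrite leq_add2r.
Qed.

(** Columns [j] and [j'] are exchanged in two blocks only. With a single block the target column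
    would get degree 1, and all columns may have degree 1 while none is empty; columns of degree 2
    are never more numerous than empty ones. Exchanging instead of moving gives an involution, so
    sums can be reindexed by it. *)
Definition switch j j' l1 l2 t : {ffun 'I_m -> block n} :=
  [ffun l => if (l == l1) || (l == l2) then ((t l).1, (tperm j j') @: (t l).2)
             else t l].

Lemma in_switch j j' l1 l2 t l i : (i \in (switch j j' l1 l2 t l).2) =
  ((if (l == l1) || (l == l2) then tperm j j' i else i) \in (t l).2).
Proof.
rewrite ffunE; case: ifP => //= _.
by rewrite -[in LHS](tpermK j j' i) mem_imset//; exact: perm_inj.
Qed.

Lemma switchK j j' l1 l2 : involutive (switch j j' l1 l2).
Proof.
move=> t; apply/ffunP => l; apply/eqP; rewrite -pair_eqE /pair_eq; apply/andP; split.
  by rewrite !ffunE; case: ifP => //= ->.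
by apply/eqP/setP => i; rewrite !in_switch; case: orb; rewrite ?tpermK.
Qed.

Section switch_col.
Variables (j j' : 'I_n) (l1 l2 : 'I_m) (a : nat) (t : {ffun 'I_m -> block n}).
Hypotheses (a2 : (2 < a)%N) (tO : t \in O) (cj : col_deg t j = a) (cj' : col_deg t j' = 0%N).
Hypotheses (l12 : l1 != l2) (jl1 : j \in (t l1).2) (jl2 : j \in (t l2).2).
Let s := switch j j' l1 l2 t.

Let notin_j' l : (j' \in (t l).2) = false.
Proof.
by move/eqP: cj'; rewrite cards_eq0 => /eqP/setP/(_ l); rewrite inE finset.in_set0.
Qed.

Lemma switch_col_blocks i : i != j -> i != j' -> col_blocks s i = col_blocks t i.
Proof.
move=> ij ij'; apply/setP => l; rewrite !inE in_switch.
by case: ifP => // _; rewrite tpermD// eq_sym.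
Qed.

Lemma switch_col_deg_src : col_deg s j = (a - 2)%N.
Proof.
rewrite -cj /col_deg -(cardsID [set l1; l2] (col_blocks t j)).
have -> : (col_blocks t j :&: [set l1; l2] = [set l1; l2])%SET.
  apply/setP => l; rewrite !inE; apply/andP/idP => [[]//|ll]; split => //.
  by case/orP: ll => /eqP ->.
rewrite cards2 l12 addKn; congr #|pred_of_set _|.
apply/setP => l; rewrite !inE in_switch; case: ifP => //= _.
by rewrite tpermL notin_j'.
Qed.

Lemma switch_col_blocks_dst : col_blocks s j' = [set l1; l2]%SET.
Proof.
apply/setP => l; rewrite !inE in_switch; case: ifP => [|_]; last by rewrite notin_j'.
by rewrite tpermR => /orP[] /eqP ->.
Qed.

(** The source column keeps degree [a - 2 > 0], so exactly one empty column is lost. This matches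
    the weights before and after a switch. *)
Lemma switch_num_deg0 : (num_deg 0 s).+1 = num_deg 0 t.
Proof.
have jj' : j != j' by apply/eqP => jj'; move: notin_j' => /(_ l1); rewrite -jj' jl1.
rewrite /num_deg (bigD1 j')//= [in RHS](bigD1 j')//= cj' eqxx.
have -> : col_deg s j' = 2%N by rewrite /col_deg switch_col_blocks_dst cards2 l12.
rewrite add0n add1n; congr S.
rewrite (bigD1 j)//= [in RHS](bigD1 j)//= cj switch_col_deg_src.
have -> : (a - 2 == 0)%N = false by rewrite subn_eq0 leqNgt a2.
have -> : (a == 0)%N = false by rewrite gtn_eqF// (ltn_trans _ a2).
congr (_ + _)%N; apply: eq_bigr => i /andP[ij' ij].
by rewrite /col_deg switch_col_blocks.
Qed.

(** Row sets do not change. A new conflict between column sets could only occur at [j] or [j'],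
    between a switched and an unswitched block; it would force a block of [t] to use [j'], which is
    empty. *)
Lemma switch_placement : s \in O.
Proof.
have /nc_placementsP[tk td] := tO; apply/nc_placementsP; split.
  move=> l; rewrite ffunE; case: ifP => //= _.
  by rewrite card_imset; [exact: tk|exact: perm_inj].
have s1 l : (s l).1 = (t l).1 by rewrite ffunE; case: ifP.
move=> l l' ll'; rewrite !s1.
have [|dl] := td _ _ ll'; [by left|right].
rewrite -setI_eq0; apply/eqP/setP => i.
rewrite finset.in_setI finset.in_set0 !in_switch.
have D i0 : i0 \in (t l).2 -> i0 \in (t l').2 -> False.
  by move=> h; rewrite (disjointFr dl h).
case: ifP => _; case: ifP => _; apply/negP => /andP[h h']; try exact: (D _ h h').
- have [ij|ij] := eqVneq i j; first by move: h; rewrite ij tpermL notin_j'.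
  have [ij'|ij'] := eqVneq i j'; first by move: h'; rewrite ij' notin_j'.
  by move: h; rewrite tpermD 1?eq_sym// => h; exact: (D _ h h').
- have [ij|ij] := eqVneq i j; first by move: h'; rewrite ij tpermL notin_j'.
  have [ij'|ij'] := eqVneq i j'; first by move: h; rewrite ij' notin_j'.
  by move: h'; rewrite tpermD 1?eq_sym// => h'; exact: (D _ h h').
Qed.

End switch_col.

Lemma sum_pairs (I : {set 'I_m}) :
  (\sum_l1 \sum_(l2 | l1 != l2) ((l1 \in I) && (l2 \in I)) = #|I| * (#|I| - 1))%N.
Proof.
rewrite (eq_bigr (fun l1 => (l1 \in I) * (#|I| - 1))%N) => [|l1 _].
  by rewrite -big_distrl /= -big_mkcond sum1_card.
case: (boolP (l1 \in I)) => l1I /=; last by rewrite mul0n big1.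
rewrite mul1n (cardsD1 l1) l1I addKn -sum1_card big_mkcond [RHS]big_mkcond.
by apply: eq_bigr => l2 _; rewrite !inE eq_sym; case: eqP => //=; case: (_ \in _).
Qed.

Context {R : realType}.

(* Move column [j] of two blocks to an empty column [j']; each switch is
   weighted by the inverse number of empty columns. *)
Lemma switching_le a : (2 < a)%N ->
  (a * (a - 1))%:R * \sum_(t in O) (num_deg a t)%:R <=
  2 * \sum_(t in O) (num_deg (a - 2)%N t)%:R :> R.
Proof.
move=> a2.
pose X j j' l1 l2 t := [&& t \in O, col_deg t j == a, col_deg t j' == 0%N,
   j \in (t l1).2 & j \in (t l2).2].
pose Y j j' l1 l2 t := [&& t \in O, col_deg t j == (a - 2)%N, col_deg t j' == 2%N,
   j' \in (t l1).2 & j' \in (t l2).2].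
have XY j j' l1 l2 : l1 != l2 ->
  \sum_t (X j j' l1 l2 t)%:R / (num_deg 0 t)%:R <=
  \sum_t (Y j j' l1 l2 t)%:R / (num_deg 0 t).+1%:R :> R.
  move=> l12; rewrite [leRHS](reindex_inj (can_inj (switchK j j' l1 l2))) /=.
  apply: ler_sum => t _; rewrite /X; case: and5P => [|_]; last first.
    by rewrite mul0r divr_ge0.
  case=> tO /eqP cj /eqP cj' jl1 jl2.
  rewrite (switch_num_deg0 a2 cj cj' l12 jl1 jl2).
  have -> : Y j j' l1 l2 (switch j j' l1 l2 t); last by [].
  apply/and5P; split.
  - exact: switch_placement.
  - by rewrite (switch_col_deg_src cj cj' l12 jl1 jl2).
  - by rewrite /col_deg (switch_col_blocks_dst cj' jl1 jl2) cards2 l12.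
  - by rewrite in_switch eqxx tpermR.
  - by rewrite in_switch eqxx orbT tpermR.
pose SX := \sum_j \sum_j' \sum_l1 \sum_(l2 | l1 != l2)
   \sum_t (X j j' l1 l2 t)%:R / (num_deg 0 t)%:R : R.
pose SY := \sum_j \sum_j' \sum_l1 \sum_(l2 | l1 != l2)
   \sum_t (Y j j' l1 l2 t)%:R / (num_deg 0 t).+1%:R : R.
have SXY : SX <= SY.
  by do 3 (apply: ler_sum => ? _); apply: ler_sum => ? ?; exact: XY.
have pull (Z : 'I_n -> 'I_n -> 'I_m -> 'I_m -> {ffun 'I_m -> block n} -> bool)
    (w : {ffun 'I_m -> block n} -> R) :
  \sum_j \sum_j' \sum_l1 \sum_(l2 | l1 != l2) \sum_t (Z j j' l1 l2 t)%:R * w t =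
  \sum_t (\sum_j \sum_j' \sum_l1 \sum_(l2 | l1 != l2) (Z j j' l1 l2 t))%N%:R * w t.
  under eq_bigr => j _.
    under eq_bigr => j' _.
      under eq_bigr => l1 _ do rewrite exchange_big.
      rewrite exchange_big. over.
    rewrite exchange_big. over.
  rewrite exchange_big; apply: eq_bigr => t _ /=.
  rewrite natr_sum mulr_suml; apply: eq_bigr => j _.
  rewrite natr_sum mulr_suml; apply: eq_bigr => j' _.
  rewrite natr_sum mulr_suml; apply: eq_bigr => l1 _.
  by rewrite natr_sum mulr_suml.
have cnt (b b' : nat) t (j0 : 'I_n -> 'I_n -> 'I_n) (d : nat) :
    (forall j j', col_deg t j = b -> col_deg t j' = b' -> col_deg t (j0 j j') = d) ->
  (\sum_j \sum_j' \sum_l1 \sum_(l2 | l1 != l2)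
     [&& t \in O, col_deg t j == b, col_deg t j' == b', j0 j j' \in (t l1).2 & j0 j j' \in (t l2).2]
   = (t \in O) * (num_deg b t * num_deg b' t * (d * (d - 1))))%N.
  move=> Hd; case: (t \in O); last by rewrite mul0n; do 3 (rewrite big1// => ? _); rewrite big1.
  rewrite mul1n /num_deg -mulnA big_distrl /=; apply: eq_bigr => j _.
  case: eqP => cj /=; last by rewrite mul0n; do 2 (rewrite big1// => ? _); rewrite big1.
  rewrite mul1n big_distrl /=; apply: eq_bigr => j' _.
  case: eqP => cj' /=; last by rewrite mul0n; rewrite big1// => ? _; rewrite big1.
  rewrite mul1n -(Hd _ _ cj cj') -sum_pairs; apply: eq_bigr => l1 _; apply: eq_bigr => l2 _.
  by rewrite !inE.
have SXE : SX = (a * (a - 1))%:R * \sum_(t in O) (num_deg a t)%:R.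
  rewrite /SX pull mulr_sumr [RHS]big_mkcond; apply: eq_bigr => t _ /=.
  rewrite (cnt a 0%N t (fun j _ => j) a)//.
  case: ifPn => tO; last by rewrite mul0n mul0r.
  rewrite mul1n.
  (* Without an empty column the weight is $1/0 = 0$, but then there is no column of degree [a]
     either. *)
  have [p0|p0] := posnP (num_deg 0 t).
    have := num_deg_le0 tO (ltnW a2); rewrite p0 leqn0 => /eqP ->.
    by rewrite !mul0n mul0r mulr0.
  by rewrite !natrM; field; rewrite gt_eqF// ltr0n.
(* The number of possible targets, [num_deg 2 t], is at most [num_deg 0 t] and cancels against the
   weight. *)
have SYE : SY <= 2 * \sum_(t in O) (num_deg (a - 2)%N t)%:R.
  rewrite /SY pull mulr_sumr [leRHS]big_mkcond; apply: ler_sum => t _ /=.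
  rewrite (cnt (a - 2)%N 2%N t (fun _ j' => j') 2%N)//.
  case: ifPn => tO; last by rewrite mul0n mul0r.
  rewrite mul1n ler_pdivrMr ?ltr0n// -!natrM ler_nat.
  rewrite subn1 muln1 mulnC mulnA leq_mul2l; apply/orP; right.
  by apply: leq_trans (num_deg_le0 tO _) (leqnSn _).
by rewrite -SXE; exact: le_trans SXY SYE.
Qed.

End column_degrees.

(** * Exponential moments of degrees *)

Section degree_moments.
Context {R : realType}.

(** Beyond [a0] the recursion makes [g a] at most half of [g (a - 2)], so the tail of the sum is
    absorbed by half of the sum itself. The factor [a] is kept on both sides: for degrees, the
    right-hand sum is then the total degree [m * k] and not the number [n] of columns. *)
Lemma factorial_decay_moment (A : R) : 0 <= A -> exists2 C : R, 0 <= C &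
  forall (q : nat -> R) (N : nat), (forall a, 0 <= q a) ->
   (forall a, (2 < a)%N -> (a * (a - 1))%:R * q a <= 2 * q (a - 2)%N) ->
   \sum_(0 <= a < N) a%:R * expR (A * a%:R) * q a <= C * \sum_(0 <= a < N) a%:R * q a.
Proof.
move=> A0.
(* In $4 e^{2A} \le (a-1)(a-2)$, one factor 2 comes from the recursion and the other from the gain
   of one half. *)
pose a0 := (Num.truncn (4 * expR (2 * A))).+4.
have ha0 a : (a0 < a)%N -> 4 * expR (2 * A) <= (a%:R - 1) * (a%:R - 2).
  move=> a0a; have H : 4 * expR (2 * A) <= a%:R - 2.
    have := truncnS_gt (4 * expR (2 * A)).
    have : (Num.truncn (4 * expR (2 * A))).+4%:R <= a%:R :> R by rewrite ler_nat ltnW.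
    rewrite -!natr1; lra.
  apply: le_trans H _; rewrite ler_peMl//.
    by rewrite subr_ge0 ler_nat; apply: leq_trans (ltnW a0a).
  have : 4%:R <= a%:R :> R by rewrite ler_nat; apply: leq_trans (ltnW a0a).
  lra.
exists (2 * expR (A * a0%:R)); first by rewrite mulr_ge0// expR_ge0.
move=> q N q0 hq.
pose g a := a%:R * expR (A * a%:R) * q a.
have g0 a : 0 <= g a by rewrite !mulr_ge0// expR_ge0.
have step a : (a0 < a)%N -> g a <= 2^-1 * g (a - 2)%N.
  move=> a0a; have a2 : (2 < a)%N by apply: leq_trans a0a.
  have := hq a a2; rewrite natrM natrB; last by apply: leq_trans a2.
  have ar : 2 < a%:R :> R by rewrite ltr_nat.
  have E2 : expR (A * a%:R) = expR (2 * A) * expR (A * (a - 2)%:R).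
    by rewrite -expRD natrB ?(ltnW a2)//; congr expR; ring.
  move=> h; rewrite /g E2.
  have h' : a%:R * q a <= 2 / (a%:R - 1) * q (a - 2)%N.
    rewrite mulrAC ler_pdivlMr; last by lra.
    by rewrite mulrAC.
  have -> : a%:R * (expR (2 * A) * expR (A * (a - 2)%:R)) * q a =
     expR (2 * A) * expR (A * (a - 2)%:R) * (a%:R * q a) by ring.
  apply: le_trans (ler_wpM2l _ h') _; first by rewrite mulr_ge0 ?expR_ge0.
  have -> : expR (2 * A) * expR (A * (a - 2)%:R) * (2 / (a%:R - 1) * q (a - 2)%N) =
    (4 * expR (2 * A) / (a%:R - 1)) * (2^-1 * (expR (A * (a - 2)%:R) * q (a - 2)%N)).
    by field; apply/eqP; lra.
  have -> : 2^-1 * ((a - 2)%:R * expR (A * (a - 2)%:R) * q (a - 2)%N) =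
     (a - 2)%:R * (2^-1 * (expR (A * (a - 2)%:R) * q (a - 2)%N)) by ring.
  rewrite ler_wpM2r ?mulr_ge0 ?invr_ge0 ?expR_ge0//.
  rewrite ler_pdivrMr; last by lra.
  by rewrite natrB ?(ltnW a2)// [leRHS]mulrC; exact: ha0.
set S := \sum_(0 <= a < N) _.
have split_S : S <= expR (A * a0%:R) * (\sum_(0 <= a < N) a%:R * q a) + 2^-1 * S.
  apply: (@le_trans _ _ (\sum_(0 <= a < N) expR (A * a0%:R) * (a%:R * q a) +
     \sum_(0 <= a < N) (if (a0 < a)%N then 2^-1 * g (a - 2)%N else 0))).
    rewrite -big_split /=; apply: ler_sum => a _.
    case: ltnP => [a0a|aa0].
      apply: le_trans (step _ a0a) _; rewrite lerDr !mulr_ge0// expR_ge0.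
    rewrite addr0 mulrAC mulrC ler_wpM2r ?mulr_ge0//.
    by rewrite ler_expR ler_wpM2l// ler_nat.
  rewrite -mulr_sumr lerD2l mulr_sumr.
  have [N2|N2] := leqP N 2.
    rewrite big_nat big1; last first.
      move=> a /andP[_ aN]; rewrite ltnNge (_ : (a <= a0)%N)//.
      by apply: leq_trans (ltnW aN) _; apply: leq_trans N2 _.
    by apply: sumr_ge0 => a _; apply: mulr_ge0 => //; exact: g0.
  rewrite (big_cat_nat (n := 2))//=; last exact: ltnW.
  rewrite big_nat big1 ?add0r; last first.
    by move=> a /andP[_ aN]; rewrite ltnNge (_ : (a <= a0)%N)// (leq_trans (ltnW aN)).
  rewrite -[X in \sum_(X <= _ < _) _](add0n 2) big_addn.
  rewrite [leRHS](big_cat_nat (n := (N - 2)%N))//= ?leq_subr//.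
  apply: ler_wpDr; first by apply: sumr_ge0 => a _; apply: mulr_ge0 => //; exact: g0.
  apply: ler_sum => a _; rewrite addnK; case: ifP => // _.
  by apply: mulr_ge0 => //; exact: g0.
by move: split_S; lra.
Qed.

Lemma sum_col_deg_moment (A : R) : 0 <= A -> exists2 C : R, 0 <= C &
  forall n m k : nat, (m * k <= n)%N ->
  \sum_(t in @ordered_placements n m (blocks n k))
    \sum_j (col_deg t j)%:R * expR (A * (col_deg t j)%:R) <=
  C * ((m * k)%:R * #|@ordered_placements n m (blocks n k)|%:R).
Proof.
move=> /factorial_decay_moment[C C0 HC]; exists C => // n m k mkn.
set O := ordered_placements _.
pose q a : R := \sum_(t in O) (num_deg a t)%:R.
have degsum (F : nat -> R) (t : {ffun 'I_m -> block n}) : \sum_j F (col_deg t j) =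
    \sum_(0 <= a < m.+1) F a * (num_deg a t)%:R.
  rewrite big_mkord.
  have cm j : (col_deg t j < m.+1)%N by rewrite ltnS; apply: leq_trans (max_card _) _; rewrite card_ord.
  rewrite (partition_big (fun j => Ordinal (cm j)) predT)//=.
  apply: eq_bigr => a _; rewrite /num_deg natr_sum mulr_sumr big_mkcond.
  apply: eq_bigr => j _; rewrite -val_eqE /=.
  by case: eqP => [->|]; rewrite ?mulr1 ?mulr0.
have H (F : nat -> R) : \sum_(t in O) \sum_j F (col_deg t j) =
    \sum_(0 <= a < m.+1) F a * q a.
  under eq_bigr do rewrite degsum.
  rewrite exchange_big; apply: eq_bigr => a _; by rewrite -mulr_sumr.
rewrite (H (fun a => a%:R * expR (A * a%:R))).
apply: le_trans (HC q m.+1 _ _) _.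
- by move=> a; exact: sumr_ge0.
- by move=> a; exact: switching_le.
rewrite -(H (fun a => a%:R)) (eq_bigr (fun=> (m * k)%:R)) => [|t tO].
  by rewrite sumr_const -[X in C * X <= _]mulr_natr.
by rewrite -natr_sum (sum_col_deg tO).
Qed.

End degree_moments.

(** * The non-consecutive family *)

Section ranks.
Context {R : realType} {n k : nat}.

Implicit Types (F : 'I_k -> R) (S : {set 'I_n}) (i : 'I_n).

Definition at_rank (F : 'I_k -> R) (S : {set 'I_n}) (i : 'I_n) : R :=
  if insub (index i (enum S)) is Some u then F u else 0.

Lemma at_rank_ge0 F S i : (forall u, 0 <= F u) -> 0 <= at_rank F S i.
Proof. by move=> F0; rewrite /at_rank; case: insub. Qed.

(** Distinct elements of [S] have distinct ranks. *)
Lemma sum_at_rank_le F S : (forall u, 0 <= F u) ->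
  \sum_(i in S) at_rank F S i <= \sum_u F u.
Proof.
move=> F0.
have E i : at_rank F S i =
    \sum_u (if insub (index i (enum S)) == Some u then F u else 0).
  rewrite /at_rank; case: insub => [u|]; last by rewrite big1.
  rewrite (bigD1 u)//= eqxx big1 ?addr0// => v vu.
  by case: eqP => // -[vu']; rewrite vu' eqxx in vu.
under eq_bigr do rewrite E.
rewrite exchange_big; apply: ler_sum => u _ /=.
rewrite -big_mkcondr /=.
have [i0 /andP[i0S /eqP i0u]|none] :=
  pickP (fun i => (i \in S) && (insub (index i (enum S)) == Some u)); last first.
  by rewrite big_pred0.
rewrite (big_pred1 i0)// => i /=; apply/andP/eqP => [[iS /eqP iu]|->]; last first.
  by rewrite i0S i0u.
have idx j : insub (index j (enum S)) = Some u -> index j (enum S) = u.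
  by case: insubP => // v _ <- [->].
have iE : i \in enum S by rewrite mem_enum.
have i0E : i0 \in enum S by rewrite mem_enum.
by rewrite -(nth_index i0 iE) (idx _ iu) -(idx _ i0u) nth_index.
Qed.

(** Composing with the transposition of [i] and [i'] preserves [S], so all elements of [S] have the
    same average over permutations, while for each permutation their values add up to at most the
    sum of [F]. *)
Lemma sum_perm_at_rank_le F S i : (forall u, 0 <= F u) -> i \in S ->
  #|S|%:R * \sum_(s : 'S_n) at_rank F (s @: S) (s i) <= n`!%:R * \sum_u F u.
Proof.
move=> F0 iS.
have E i' : i' \in S -> \sum_(s : 'S_n) at_rank F (s @: S) (s i) =
    \sum_(s : 'S_n) at_rank F (s @: S) (s i').
  move=> i'S; rewrite (reindex_inj (mulgI (tperm i i'))) /=.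
  apply: eq_bigr => s _; rewrite permM tpermL; congr (at_rank _ _ _).
  apply/setP => j; apply/imsetP/imsetP => -[i0 i0S ->].
  - exists (tperm i i' i0); last by rewrite permM.
    by case: tpermP => // ->.
  - exists (tperm i i' i0); last by rewrite permM tpermK.
    by case: tpermP => // ->.
rewrite mulr_natl -sumr_const (eq_bigr _ (fun i' h => E i' h)) exchange_big /=.
apply: (@le_trans _ _ (\sum_(s : 'S_n) \sum_u F u)); last first.
  by rewrite sumr_const card_Sn mulr_natl.
apply: ler_sum => s _; apply: le_trans (sum_at_rank_le (s @: S) F0).
by rewrite big_imset//= => ? ? _ _; exact: perm_inj.
Qed.

End ranks.

(** * Permuted placements, row weights and row degrees *)

Section noncontiguous.
Context {R : realType} {n m k : nat}.
Local Notation tuples := {ffun 'I_m -> block n}.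
Local Notation O := (@ordered_placements n m (blocks n k)).
Implicit Types t : tuples.

Definition transpose_tuple t : tuples := [ffun l => ((t l).2, (t l).1)].

Lemma transpose_tupleK : involutive transpose_tuple.
Proof. by move=> t; apply/ffunP => l; rewrite !ffunE /=; case: (t l). Qed.

Lemma transpose_tuple_placement t : (transpose_tuple t \in O) = (t \in O).
Proof.
suff H s : s \in O -> transpose_tuple s \in O.
  by apply/idP/idP => [/H|/H//]; rewrite transpose_tupleK.
move=> /nc_placementsP[sk sd]; apply/nc_placementsP; split => [l|l l' ll'].
  by rewrite ffunE /=; have [-> ->] := sk l.
by rewrite !ffunE /=; case: (sd _ _ ll'); [right|left].
Qed.

(** Defined by transposition, so that the moment bound for columns serves for rows. *)
Definition row_deg t i := col_deg (transpose_tuple t) i.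

Lemma row_degE t i : row_deg t i = (\sum_l (i \in (t l).1))%N.
Proof.
rewrite /row_deg /col_deg -sum1_card big_mkcond /=; apply: eq_bigr => l _.
by rewrite inE ffunE.
Qed.

Lemma col_degE t j : col_deg t j = (\sum_l (j \in (t l).2))%N.
Proof.
rewrite /col_deg -sum1_card big_mkcond /=; apply: eq_bigr => l _.
by rewrite inE.
Qed.

Definition permute_tuple (h : 'S_n * 'S_n) t : tuples :=
  [ffun l => (h.1 @: (t l).1, h.2 @: (t l).2)].

Lemma permute_tuple_placement h t : t \in O -> permute_tuple h t \in O.
Proof.
move=> /nc_placementsP[tk td]; apply/nc_placementsP; split => [l|l l' ll'].
  by rewrite ffunE /= !card_imset; [exact: tk|exact: perm_inj|exact: perm_inj].
rewrite !ffunE /= -!setI_eq0 -!imsetI ?imset_eq0 ?setI_eq0; [exact: td| |];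
  by move=> ? ? _ _; exact: perm_inj.
Qed.

Lemma permute_tupleM h h' t :
  permute_tuple h' (permute_tuple h t) = permute_tuple (h.1 * h'.1, h.2 * h'.2)%g t.
Proof.
apply/ffunP => l; rewrite !ffunE /= -!imset_comp.
by congr (_, _); apply: eq_imset => i; rewrite /= permM.
Qed.

Lemma permute_tuple1 t : permute_tuple (1%g, 1%g) t = t.
Proof.
apply/ffunP => l; rewrite ffunE [RHS]surjective_pairing.
by congr (_, _); rewrite -[RHS]imset_id; apply: eq_imset => i; rewrite /= perm1.
Qed.

Lemma permute_tupleK h : cancel (permute_tuple h) (permute_tuple (h.1^-1, h.2^-1)%g).
Proof. by move=> t; rewrite permute_tupleM /= !mulgV permute_tuple1. Qed.

Lemma sum_permute_tuple h (F : tuples -> R) :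
  \sum_(t in O) F (permute_tuple h t) = \sum_(t in O) F t.
Proof.
rewrite [RHS](reindex_inj (can_inj (permute_tupleK h))); apply: eq_bigl => t.
apply/idP/idP => [|H]; first exact: permute_tuple_placement.
by rewrite -(permute_tupleK h t); exact: permute_tuple_placement.
Qed.

Lemma row_deg_permute h t i : row_deg (permute_tuple h t) (h.1 i) = row_deg t i.
Proof.
rewrite !row_degE; apply: eq_bigr => l _; rewrite ffunE /= mem_imset//.
exact: perm_inj.
Qed.

Lemma template_cell_isSome t c : t \in O ->
  isSome (@template_cell n m k t c) = [exists l, c \in cells (t l)].
Proof.
move=> tO; have /nc_placementsP[tk _] := tO.
apply/idP/existsP => [|[l cl]].
  by rewrite /template_cell /covering; case: pickP => // l cl _; exists l.
rewrite /template_cell (covering_eq tO cl) /block_coord.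
case: c cl => i j; rewrite finset.in_setX /= => /andP[iS jT].
have [S T] := tk l.
have h (A : {set 'I_n}) i0 : #|A| = k -> i0 \in A -> (index i0 (enum A) < k)%N.
  by move=> Ak i0A; rewrite -Ak cardE index_mem mem_enum.
by rewrite !insubT; [exact: h|exact: h|].
Qed.

Lemma template_cell_permute h t i j : t \in O ->
  isSome (@template_cell n m k (permute_tuple h t) (h.1 i, h.2 j)) =
  isSome (@template_cell n m k t (i, j)).
Proof.
move=> tO; rewrite !template_cell_isSome//; last exact: permute_tuple_placement.
apply: eq_existsb => l; rewrite !finset.in_setX ffunE /= !mem_imset//; exact: perm_inj.
Qed.

Variable x : 'I_m -> 'I_k * 'I_k -> R.
Hypothesis x0 : forall l u, 0 <= x l u.

Lemma sum_row_weight_le t i : t \in O ->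
  \sum_j template_weight x t (i, j) <=
  \sum_l (i \in (t l).1)%:R * at_rank (fun u => \sum_v x l (u, v)) (t l).1 i.
Proof.
move=> tO.
apply: (@le_trans _ _ (\sum_j \sum_l ((i \in (t l).1) && (j \in (t l).2))%:R *
    at_rank (fun u => at_rank (fun v => x l (u, v)) (t l).2 j) (t l).1 i)).
  apply: ler_sum => j _; rewrite /template_weight /template_cell /covering.
  have rhs0 (p : pred 'I_m) : 0 <= \sum_(l | p l) ((i \in (t l).1) && (j \in (t l).2))%:R *
    at_rank (fun u => at_rank (fun v => x l (u, v)) (t l).2 j) (t l).1 i.
    apply: sumr_ge0 => l _; rewrite mulr_ge0// at_rank_ge0// => u.
    exact: at_rank_ge0.
  case: pickP => [l|_] //; rewrite finset.in_setX /= => cl.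
  rewrite (bigD1 l)//= cl mul1r; apply: ler_wpDr; first exact: rhs0.
  rewrite /block_coord /at_rank /=.
  by case: insub => // u; case: insub.
rewrite exchange_big; apply: ler_sum => l _ /=.
case iS : (i \in (t l).1) => /=; last by rewrite mul0r big1// => j _; rewrite mul0r.
rewrite mul1r /at_rank.
case: (insub (index i (enum (t l).1)) : option 'I_k) => [u|]; last first.
  by rewrite big1// => j _; rewrite mulr0.
apply: le_trans (sum_at_rank_le (t l).2 (fun v => x0 l (u, v))).
rewrite [leRHS]big_mkcond; apply: ler_sum => j _ /=.
by case: ifP; rewrite ?mul1r ?mul0r.
Qed.

Lemma sum_cells_row_le t i : t \in O ->
  (\sum_j isSome (@template_cell n m k t (i, j)) <= k * row_deg t i)%N.
Proof.
move=> tO; have /nc_placementsP[tk _] := tO.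
rewrite row_degE big_distrr /=.
apply: (@leq_trans (\sum_j \sum_l (i \in (t l).1) * (j \in (t l).2))%N).
  apply: leq_sum => j _; rewrite template_cell_isSome//.
  case: existsP => // -[l]; rewrite finset.in_setX /= => /andP[i1 j1].
  by rewrite (bigD1 l)//= i1 j1.
rewrite exchange_big; apply: leq_sum => l _ /=.
rewrite -big_distrr /= mulnC leq_mul2r; apply/orP; right.
by have [_ <-] := tk l; rewrite -sum1_card [leqRHS]big_mkcond.
Qed.

Lemma sum_cells_col_le t j : t \in O ->
  (\sum_i isSome (@template_cell n m k t (i, j)) <= k * col_deg t j)%N.
Proof.
move=> tO; have /nc_placementsP[tk _] := tO.
rewrite col_degE big_distrr /=.
apply: (@leq_trans (\sum_i \sum_l (j \in (t l).2) * (i \in (t l).1))%N).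
  apply: leq_sum => i _; rewrite template_cell_isSome//.
  case: existsP => // -[l]; rewrite finset.in_setX /= => /andP[i1 j1].
  by rewrite (bigD1 l)//= i1 j1.
rewrite exchange_big; apply: leq_sum => l _ /=.
rewrite -big_distrr /= mulnC leq_mul2r; apply/orP; right.
by have [<- _] := tk l; rewrite -sum1_card [leqRHS]big_mkcond.
Qed.

Variable th : R.
Hypothesis k0 : (0 < k)%N.
Hypothesis sum_x : forall l, \sum_u x l u <= (k ^ 2)%:R * th.

(* The rank of a row within its block is uniform under row permutations, so
   the row sums of the templates may be replaced by their averages. *)
Lemma sum_row_weight_deg_le (A : R) :
  \sum_(t in O) \sum_i (\sum_j template_weight x t (i, j)) * expR (A * (row_deg t i)%:R) <=
  k%:R * th * \sum_(t in O) \sum_i (row_deg t i)%:R * expR (A * (row_deg t i)%:R).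
Proof.
pose rho l u : R := \sum_v x l (u, v).
have rho0 l u : 0 <= rho l u by exact: sumr_ge0.
pose Phi t : R := \sum_i \sum_l (i \in (t l).1)%:R * at_rank (rho l) (t l).1 i *
   expR (A * (row_deg t i)%:R).
apply: (@le_trans _ _ (\sum_(t in O) Phi t)).
  apply: ler_sum => t tO; apply: ler_sum => i _; rewrite -mulr_suml.
  by rewrite ler_wpM2r ?expR_ge0//; exact: sum_row_weight_le.
have n0 : 0 < n`!%:R :> R by rewrite ltr0n fact_gt0.
rewrite -(ler_pM2l n0).
have -> : n`!%:R * \sum_(t in O) Phi t = \sum_(s : 'S_n) \sum_(t in O) Phi (permute_tuple (s, 1%g) t).
  under [RHS]eq_bigr do rewrite sum_permute_tuple.
  by rewrite sumr_const card_Sn mulr_natl.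
rewrite exchange_big mulrA mulr_sumr; apply: ler_sum => t tO /=.
have /nc_placementsP[tk _] := tO.
have -> : \sum_(s : 'S_n) Phi (permute_tuple (s, 1%g) t) =
   \sum_i \sum_l (i \in (t l).1)%:R * expR (A * (row_deg t i)%:R) *
      \sum_(s : 'S_n) at_rank (rho l) (s @: (t l).1) (s i).
  transitivity (\sum_(s : 'S_n) \sum_i \sum_l (i \in (t l).1)%:R * expR (A * (row_deg t i)%:R) *
     at_rank (rho l) (s @: (t l).1) (s i)).
    apply: eq_bigr => s _; rewrite /Phi (reindex_inj (@perm_inj _ s)) /=.
    apply: eq_bigr => i _; apply: eq_bigr => l _.
    rewrite (row_deg_permute (s, 1%g)) ffunE /= mem_imset; last exact: perm_inj.
    by rewrite mulrAC.
  rewrite exchange_big; apply: eq_bigr => i _; rewrite exchange_big.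
  by apply: eq_bigr => l _; rewrite mulr_sumr.
rewrite mulr_sumr; apply: ler_sum => i _.
set E := expR _; rewrite row_degE natr_sum mulr_suml mulr_sumr; apply: ler_sum => l _.
case: (boolP (i \in (t l).1)) => iS; last by rewrite !(mul0r, mulr0).
rewrite !mul1r mulrC ler_wpM2r ?expR_ge0//.
have := sum_perm_at_rank_le (rho0 l) iS; have [-> _] := tk l.
have : \sum_u rho l u <= (k ^ 2)%:R * th.
  by apply: le_trans (sum_x l); rewrite pair_bigA; apply: ler_sum => -[u v].
have k0r : 0 < k%:R :> R by rewrite ltr0n.
move=> h1 h2; rewrite -(ler_pM2l k0r); apply: le_trans h2 _.
rewrite [leRHS](_ : _ = n`!%:R * ((k ^ 2)%:R * th)); last by rewrite natrX; ring.
by rewrite ler_wpM2l.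
Qed.

End noncontiguous.

(** * Cyclic intervals and existence of placements *)

Section cyclic_intervals.
Context {n : nat}.

Lemma in_cyclic_interval k (i j : 'I_n) :
  (j \in cyclic_interval k i) = [exists r : 'I_k, nat_of_ord j == (i + r) %% n]%N.
Proof. by rewrite inE. Qed.

Lemma card_cyclic_interval k (i : 'I_n) : (k <= n)%N -> #|cyclic_interval k i| = k.
Proof.
move=> kn; have n0 : (0 < n)%N by apply: leq_ltn_trans (ltn_ord i).
pose f (r : 'I_k) : 'I_n := Ordinal (ltn_pmod (i + r) n0).
have -> : cyclic_interval k i = f @: finset.setT.
  apply/setP => j; rewrite in_cyclic_interval; apply/existsP/imsetP => [[r /eqP jr]|[r _ ->]].
    by exists r => //; apply: val_inj.
  by exists r.
rewrite card_imset ?cardsT ?card_ord// => r r' /(congr1 val) /= /eqP.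
rewrite eqn_modDl !modn_small ?(leq_trans (ltn_ord _))// => /eqP.
exact: val_inj.
Qed.

(** Diagonal blocks starting at the multiples of [k]; they do not wrap around since $mk \le n$. As
    circular blocks are blocks, this witness serves both families. *)
Lemma ordered_circ_placements_neq0 m k : (0 < k)%N -> (m * k <= n)%N ->
  exists t : {ffun 'I_m -> block n}, t \in ordered_placements (circ_blocks n k).
Proof.
move=> k0 mkn.
have lt0 (l : 'I_m) r : (r < k)%N -> (l * k + r < n)%N.
  move=> rk; apply: leq_trans mkn; apply: (@leq_trans (l.+1 * k)).
    by rewrite mulSn addnC ltn_add2r.
  by rewrite leq_mul2r ltn_ord orbT.
have ltn0 (l : 'I_m) : (l * k < n)%N by rewrite -[X in (X < _)%N]addn0; exact: lt0.
exists [ffun l => (cyclic_interval k (Ordinal (ltn0 l)), cyclic_interval k (Ordinal (ltn0 l)))].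
apply/ordered_placementsP; split.
  by move=> l; rewrite ffunE inE /=; apply/andP; split; apply/existsP; exists (Ordinal (ltn0 l)).
move=> l l' ll'; rewrite disjoint_cells !ffunE /= orbb -setI_eq0.
apply/eqP/setP => i; rewrite finset.in_setI finset.in_set0 !in_cyclic_interval /=.
apply/negP => /andP[/existsP[r /eqP ir] /existsP[r' /eqP ir']].
move: ir'; rewrite ir !modn_small ?lt0// => E; move/eqP: ll'; apply; apply: val_inj => /=.
have := congr1 (divn^~ k) E; rewrite !divnMDl// !divn_small// !addn0.
by [].
Qed.

Lemma circ_blocks_sub_blocks k : (k <= n)%N -> circ_blocks n k \subset blocks n k.
Proof.
move=> kn; apply/fintype.subsetP => B; rewrite !inE.
by move=> /andP[/existsP[i /eqP ->] /existsP[j /eqP ->]]; rewrite !card_cyclic_interval// eqxx.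
Qed.

Lemma ordered_placements_sub m (bl bl' : {set block n}) : bl \subset bl' ->
  ordered_placements bl \subset @ordered_placements n m bl'.
Proof.
move=> bb; apply/fintype.subsetP => t /ordered_placementsP[H1 H2].
by apply/ordered_placementsP; split => // l; exact: (fintype.subsetP bb).
Qed.

Lemma blocks_cells_neq0 k B : (0 < k)%N -> B \in blocks n k -> cells B != finset.set0.
Proof.
move=> k0; rewrite inE => /andP[/eqP B1 /eqP B2].
by rewrite -card_gt0 cardsX B1 B2 muln_gt0 k0.
Qed.

End cyclic_intervals.

(** * The non-consecutive mixture is close to the null law *)

Section nc_close.
Context {R : realType}.
Local Notation RR := (measurableTypeR R).

Lemma markov_count (T : finType) (O : {set T}) (F : T -> R) (a b : R) :
  (forall t, 0 <= F t) -> 0 < b -> \sum_(t in O) F t <= a * b * #|O|%:R ->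
  forall C, 0 < C -> \sum_(t in O) (~~ (F t <= C * b))%:R <= a / C * #|O|%:R.
Proof.
move=> F0 b0 H C C0; have Cb : 0 < C * b by rewrite mulr_gt0.
rewrite -(ler_pM2l Cb); apply: le_trans (_ : _ <= \sum_(t in O) F t) _.
  rewrite mulr_sumr; apply: ler_sum => t _.
  by case: (lerP (F t) (C * b)) => h; rewrite /= ?mulr0// mulr1 ltW.
apply: le_trans H _; rewrite le_eqVlt; apply/orP; left; apply/eqP.
by field; rewrite gt_eqF.
Qed.

(** The constants are chosen in a forced order: [C1] truncates the column moment, the exponent of
    the row moment depends on [C1], and [C3] truncates that row moment. Each truncation discards a
    proportion at most [eta / 2] of the placements. *)
Lemma nc_close (eta : R) : 0 < eta -> exists2 K : R, 0 <= K &
  forall (n m k : nat) (P : 'I_m -> 'I_k * 'I_k -> probability RR R) (th : R),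
  (0 < m)%N -> (0 < k)%N -> (m * k <= n)%N ->
  (forall l u, P l u `<< @std_normal R) -> (Theta_star P <= th%:E)%E ->
  0 < th -> th <= k%:R^-1 ->
  let O := @ordered_placements n m (blocks n k) in
  forall (e : R) (A : set _), 0 < e -> measurable A ->
  `|\sum_(t in O) fine (matrix_law (template_law P t) A) / #|O|%:R
    - fine (law_H0 n A)| <=
  e / 2 + (expR (K * (m%:R ^+ 2 * k%:R ^+ 4 * th / n%:R ^+ 2)) - 1 + 2 * eta) / (2 * e) + eta.
Proof.
move=> eta0.
have [Ca Ca0 HCa] := sum_col_deg_moment (ler0n R 3).
have pick_const (a : R) : 0 <= a -> exists2 C : R, 0 < C & a / C <= eta / 2.
  move=> a0; exists (2 * (a + 1) / eta); first by rewrite divr_gt0// mulr_gt0// ltr_wpDl.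
  rewrite invf_div mulrCA ler_wpM2l ?(ltW eta0)// ler_pdivrMr ?mulr_gt0 ?ltr_wpDl//.
  by rewrite mulrA mulVf ?pnatr_eq0// mul1r lerDl.
have [C1 C10 c1] := pick_const Ca Ca0.
have A0 : 0 <= 3 * expR 1 * C1 :> R by rewrite !mulr_ge0 ?expR_ge0// ltW.
have [Cb Cb0 HCb] := sum_col_deg_moment A0.
have [C3 C30 c2] := pick_const Cb Cb0.
exists (expR 1 ^+ 2 * C1 * C3).
  by rewrite !mulr_ge0 ?expR_ge0 ?(ltW C10) ?(ltW C30).
move=> n m k P th m0 k0 mkn P_ac HT th0 thk O e A e0 mA.
have n0 : (0 < n)%N by apply: leq_trans mkn; rewrite muln_gt0 m0.
have [x [x0 xE hx]] := Theta_star_chi2 m0 k0 P_ac HT.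
have sum_x l : \sum_u x l u <= (k ^ 2)%:R * th by exact: (sum_chi2_le m0 k0 (hx l)).
have k0r : 0 < k%:R :> R by rewrite ltr0n.
have m0r : 0 < m%:R :> R by rewrite ltr0n.
(* The cap on [th] enters here: $1/k + 2/k = 3/k$. *)
have x3 l u : x l u <= 3 / k%:R.
  apply: le_trans (chi2_le m0 k0 (hx l) u) _.
  by apply: le_trans (lerD thk (lexx _)) _; lra.
have kn : (k <= n)%N by apply: leq_trans mkn; rewrite leq_pmull.
have O0 : (0 < #|O|)%N.
  have [t tO] := ordered_circ_placements_neq0 k0 mkn.
  apply/card_gt0P; exists t; apply: (fintype.subsetP _ _ tO).
  by apply: ordered_placements_sub; exact: circ_blocks_sub_blocks.
have O0r : 0 < #|O|%:R :> R by rewrite ltr0n.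
pose F1 (t : {ffun 'I_m -> block n}) : R := \sum_j (col_deg t j)%:R * expR (3 * (col_deg t j)%:R).
pose F2 (t : {ffun 'I_m -> block n}) : R := \sum_i (\sum_j template_weight x t (i, j)) *
   expR (3 * expR 1 * C1 * (row_deg t i)%:R).
pose G1 t := F1 t <= C1 * (m * k)%:R.
pose G2 t := F2 t <= C3 * (m%:R * k%:R ^+ 2 * th).
pose G t := G1 t && G2 t.
have F10 t : 0 <= F1 t by apply: sumr_ge0 => j _; rewrite mulr_ge0// expR_ge0.
have F20 t : 0 <= F2 t.
  apply: sumr_ge0 => j _; rewrite mulr_ge0 ?expR_ge0// sumr_ge0// => i _.
  exact: template_weight_ge0.
have bad1 : \sum_(t in O) (~~ G1 t)%:R <= Ca / C1 * #|O|%:R.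
  apply: markov_count => //; first by rewrite ltr0n muln_gt0 m0.
  by rewrite -mulrA; exact: HCa.
have bad2 : \sum_(t in O) (~~ G2 t)%:R <= Cb / C3 * #|O|%:R.
  apply: markov_count => //; first by rewrite !mulr_gt0// exprn_gt0.
  apply: le_trans (sum_row_weight_deg_le x0 k0 sum_x _) _.
  rewrite (_ : \sum_(t in O) _ = \sum_(t in O) \sum_i (col_deg t i)%:R *
      expR (3 * expR 1 * C1 * (col_deg t i)%:R)); last first.
    rewrite [LHS](reindex_inj (can_inj (@transpose_tupleK n m))) /=.
    apply: eq_big => t; first exact: transpose_tuple_placement.
    by move=> _; apply: eq_bigr => i _; rewrite /row_deg transpose_tupleK.
  apply: le_trans (ler_wpM2l _ (HCb n m k mkn)) _; first by rewrite mulr_ge0// ltW.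
  by rewrite le_eqVlt natrM; apply/orP; left; apply/eqP; ring.
pose s : R := (\sum_(t in O) (G t)%:R) / #|O|%:R.
have s1 : 1 - eta <= s.
  rewrite ler_pdivlMr//.
  have : \sum_(t in O) (1 : R) <= \sum_(t in O) (G t)%:R +
      (\sum_(t in O) (~~ G1 t)%:R + \sum_(t in O) (~~ G2 t)%:R).
    rewrite -!big_split /=; apply: ler_sum => t _.
    by rewrite /G; case: (G1 t); case: (G2 t); rewrite /= ?addr0 ?add0r// lerDl.
  rewrite sumr_const => h.
  have d1 := le_trans bad1 (ler_wpM2r (ltW O0r) c1).
  have d2 := le_trans bad2 (ler_wpM2r (ltW O0r) c2).
  have ->: (1 - eta) * #|O|%:R = #|O|%:R - (eta / 2 * #|O|%:R + eta / 2 * #|O|%:R) by field.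
  by rewrite lerBlDr; apply: le_trans h _; rewrite lerD2l; exact: lerD.
set V := expR _.
have invK : involutive (fun h : 'S_n * 'S_n => (h.1^-1, h.2^-1)%g).
  by move=> h; rewrite /= !invgK -surjective_pairing.
have mulK (h : 'S_n * 'S_n) : cancel (fun h' : 'S_n * 'S_n => (h.1 * h'.1, h.2 * h'.2)%g)
    (fun h' => (h.1^-1 * h'.1, h.2^-1 * h'.2)%g).
  by move=> h'; rewrite /= !mulKg -surjective_pairing.
have cell_le t : t \in O -> G t ->
   \sum_(h : 'S_n * 'S_n) expR (overlap x t (permute_tuple h t)) <= V * n`!%:R ^+ 2.
  move=> tO /andP[g1 g2].
  pose M i j := isSome (@template_cell n m k t (i, j)).
  have := @sum_perm2_expR_le R n m k M (fun i j => template_weight x t (i, j))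
     (row_deg t) (col_deg t) C1 C3 th k0 n0 mkn.
  rewrite -/V => H; rewrite [leRHS]mulrC; apply: le_trans (H _ _ _ _ _ _ _).
  (* A cell is covered by the permuted placement when its preimage is covered by [t]; inverting [h]
     turns this into the form [M (s i) (t j)]. *)
  - rewrite pair_bigA /= (reindex_inj (inv_inj invK)).
    rewrite le_eqVlt; apply/orP; left; apply/eqP; apply: eq_bigr => h _.
    congr expR; rewrite /overlap pair_bigA; apply: eq_bigr => -[i j] _ /=.
    rewrite mulrC; congr (_ * _); congr (_%:R); congr nat_of_bool.
    have := @template_cell_permute n m k (h.1^-1, h.2^-1)%g t (h.1 i) (h.2 j) tO.
    by rewrite /= !permK.
  - by move=> i j; exact: template_weight_ge0.
  - move=> i j; rewrite /M /template_weight; case: template_cell => [lu|] /=.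
      by rewrite mulr1.
    by rewrite mulr0.
  - by move=> i; exact: sum_cells_row_le.
  - by move=> j; exact: sum_cells_col_le.
  - exact: ltW.
  - exact: g1.
  - exact: g2.
have cardS : #|{: 'S_n * 'S_n}|%:R = n`!%:R ^+ 2 :> R.
  by rewrite card_prod card_Sn natrM expr2.
have := @mixture_close R n m k P x O {ffun 'I_m -> block n} ('S_n * 'S_n)%type O
   (fun t h => permute_tuple h t) G V s e A P_ac xE O0 O0 _ _ _ e0 mA erefl.
move=> H; apply: le_trans (H _ _ _) _.
- by rewrite card_prod !card_Sn muln_gt0 !fact_gt0.
- move=> F; rewrite exchange_big /=.
  under eq_bigr => h _ do rewrite -mulr_suml sum_permute_tuple.
  rewrite sumr_const -mulr_suml -[LHS]mulr_natr -mulrA; congr (_ * _).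
  by field; rewrite !gt_eqF// ltr0n card_prod !card_Sn muln_gt0 !fact_gt0.
- rewrite exchange_big /=.
  (* Both placements are permutations of the same [t]. Invariance of the sum over [O] makes the
     first one [t] itself, and the second becomes a uniform permutation of it. *)
  have -> : \sum_(h : 'S_n * 'S_n) \sum_(t in O) \sum_(h' : 'S_n * 'S_n)
     (G (permute_tuple h t))%:R * expR (overlap x (permute_tuple h t) (permute_tuple h' t)) =
     \sum_(h : 'S_n * 'S_n) \sum_(t in O) \sum_(h' : 'S_n * 'S_n)
     (G t)%:R * expR (overlap x t (permute_tuple h' t)).
    apply: eq_bigr => h _.
    rewrite -(sum_permute_tuple h (fun t => \sum_(h' : 'S_n * 'S_n)
      (G t)%:R * expR (overlap x t (permute_tuple h' t)))).
    apply: eq_bigr => t _.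
    rewrite (reindex_inj (can_inj (mulK h))) /=.
    by apply: eq_bigr => h' _; rewrite permute_tupleM.
  rewrite sumr_const -[leLHS]mulr_natr cardS mulrA.
  rewrite [leRHS](_ : _ = V * n`!%:R ^+ 2 * #|O|%:R * n`!%:R ^+ 2); last by ring.
  rewrite ler_wpM2r ?exprn_ge0// mulr_natr -sumr_const; apply: ler_sum => t tO.
  rewrite -mulr_sumr; case: (boolP (G t)) => Gt.
    by rewrite mul1r; exact: cell_le.
  by rewrite mul0r mulr_ge0 ?expR_ge0 ?exprn_ge0.
- apply: lerD; last by lra.
  rewrite lerD2l ler_wpM2r ?invr_ge0 ?mulr_ge0 ?(ltW e0)//; lra.
Qed.

End nc_close.

(** * The circular family *)

Section resampling.
Context {R : realType} {I T : finType}.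
Implicit Types t : {ffun I -> T}.

Definition update t i (b : T) : {ffun I -> T} := [ffun l => if l == i then b else t l].

(** Exchanging [b] with the coordinate [t i] is an involution of the pairs [(t, b)]. *)
Lemma sum_update i (F : {ffun I -> T} -> R) :
  \sum_t \sum_b F (update t i b) = #|T|%:R * \sum_t F t.
Proof.
have invU : involutive (fun p : {ffun I -> T} * T => (update p.1 i p.2, p.1 i)).
  move=> [t b] /=; congr (_, _); last by rewrite ffunE eqxx.
  by apply/ffunP => l; rewrite !ffunE; case: eqP => [->|].
rewrite pair_bigA (reindex_inj (inv_inj invU)) /=.
rewrite -(pair_bigA _ (fun t b => F (update (update t i b) i (t i)))) /= mulr_sumr.
apply: eq_bigr => t _.
rewrite (eq_bigr (fun=> F t)) ?sumr_const ?mulr_natl// => b _.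
by congr F; apply/ffunP => l; rewrite !ffunE; case: eqP => [->|].
Qed.

(** Coordinates are averaged out one by one. When coordinate [i] is resampled among the values that
    keep the tuple in [O], the other factors do not change and [f] averages to at most [a] whatever
    the other coordinates are. *)
Lemma resampling_le (O : {set {ffun I -> T}}) (f : T -> R) (a : R) : 0 <= a ->
  (forall b, 0 <= f b) ->
  (forall t i, t \in O -> \sum_(b | update t i b \in O) f b <=
                          a * #|[set b | update t i b \in O]%SET|%:R) ->
  \sum_(t in O) \prod_i f (t i) <= a ^+ #|I| * #|O|%:R.
Proof.
move=> a0 f0 Hf.
suff H (s : seq I) : uniq s ->
    \sum_(t in O) \prod_(i <- s) f (t i) <= a ^+ size s * #|O|%:R.
  have := H (enum I) (enum_uniq I); rewrite -cardE.
  by under eq_bigr do rewrite big_enum.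
elim: s => [_|i s IH /= /andP[is_ us]].
  by under eq_bigr do rewrite big_nil; rewrite sumr_const expr0 mul1r.
rewrite exprS -mulrA; apply: le_trans (ler_wpM2l a0 (IH us)).
pose g t := \prod_(l <- s) f (t l).
have gE t b : g (update t i b) = g t.
  apply: eq_big_seq => l ls; rewrite ffunE; case: eqP => // li.
  by rewrite -li ls in is_.
under eq_bigr do rewrite big_cons.
have g0 t : 0 <= g t by apply: prodr_ge0.
have [T0|T0] := posnP #|T|.
  rewrite !big1 ?mulr0// => t _; have := card0_eq T0 (t i); rewrite inE//.
have T0r : 0 < #|T|%:R :> R by rewrite ltr0n.
(* The factor [#|T|] pays for a free value at [i], so that both sides can be compared for each fixed
   [t]. *)
rewrite -(ler_pM2l T0r) mulrCA.
rewrite (big_mkcond (mem O)) [X in _ <= _ * (_ * X)](big_mkcond (mem O)) /= -!(sum_update i).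
rewrite mulr_sumr; apply: ler_sum => t _.
rewrite -!big_mkcond /=.
have [b0 b0O|none] := pickP (fun b => update t i b \in O); last first.
  by rewrite !big_pred0// mulr0.
under eq_bigr => b _ do rewrite ffunE eqxx -/(g _) gE.
rewrite -/(g t) -mulr_suml.
rewrite [X in a * X](eq_bigr (fun=> g t)) => [|b _]; last exact: gE.
rewrite sumr_const -[X in a * X]mulr_natl mulrA ler_wpM2r//.
have upd2 b : update (update t i b0) i b = update t i b.
  by apply/ffunP => l; rewrite !ffunE; case: eqP.
have := Hf _ i b0O.
under eq_bigl do rewrite upd2; move=> /le_trans; apply.
rewrite ler_wpM2l// ler_nat; apply/eq_leq/eq_card => b.
by rewrite inE upd2.
Qed.

End resampling.

(** * Counting circular blocks *)

Section circular_geometry.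
Context {n k : nat}.
Hypotheses (k0 : (0 < k)%N) (kn : (2 * k <= n)%N).

Definition intervals : {set {set 'I_n}} := [set cyclic_interval k i | i : 'I_n]%SET.

Lemma circ_blocksE : circ_blocks n k = finset.setX intervals intervals.
Proof.
apply/setP => -[S T]; rewrite finset.in_setX inE /=.
congr (_ && _); apply/existsP/imsetP => [[i /eqP ->]|[i _ ->]].
- by exists i. - by exists i. - by exists i. - by exists i.
Qed.

(** The starting point can be recovered: if two starting points give the same interval, each lies in
    it, and their mutual offsets add up to a multiple of [n] that is smaller than [n], hence
    vanish. *)
Lemma card_intervals : #|intervals| = n.
Proof.
rewrite card_imset ?card_ord// => i i' E; apply: val_inj => /=.
have n0 : (0 < n)%N by apply: leq_ltn_trans (ltn_ord i).
have self (j : 'I_n) : j \in cyclic_interval k j.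
  by rewrite in_cyclic_interval; apply/existsP; exists (Ordinal k0); rewrite addn0 modn_small.
have := self i'; rewrite -E in_cyclic_interval => /existsP[r /eqP ir].
have := self i; rewrite E in_cyclic_interval => /existsP[r' /eqP ir'].
have rr : (r + r' < n)%N.
  by apply: leq_trans kn; rewrite mul2n -addnn -addSn leq_add// ltnW.
have : (i + (r + r') == i + 0 %[mod n])%N.
  by rewrite addnA -modnDml -ir -ir' addn0 modn_small.
rewrite eqn_modDl (modn_small rr) mod0n addn_eq0 => /andP[/eqP r0 _].
by rewrite ir r0 addn0 modn_small.
Qed.

Lemma card_intervals_mem (j : 'I_n) : (#|[set I in intervals | j \in I]%SET| <= k)%N.
Proof.
have n0 : (0 < n)%N by apply: leq_ltn_trans (ltn_ord j).
pose f (r : 'I_k) := cyclic_interval k (Ordinal (ltn_pmod (j + (n - r)) n0)).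
rewrite -[leqRHS](card_ord k); apply: leq_trans (leq_imset_card f _).
apply: subset_leq_card; apply/fintype.subsetP => I; rewrite inE => /andP[/imsetP[i _ ->]].
rewrite in_cyclic_interval => /existsP[r /eqP jr]; apply/imsetP; exists r => //.
congr cyclic_interval; apply: val_inj => /=.
rewrite jr modnDml -addnA subnKC ?modnDr ?modn_small//.
by rewrite ltnW// (leq_trans (ltn_ord r))// (leq_trans _ kn)// leq_pmull.
Qed.

Lemma card_intervals_meet (I0 : {set 'I_n}) : I0 \in intervals ->
  (#|[set I in intervals | ~~ [disjoint I & I0]]%SET| <= 2 * k)%N.
Proof.
move=> /imsetP[i0 _ ->].
have n0 : (0 < n)%N by apply: leq_ltn_trans (ltn_ord i0).
have kn' : (k <= n)%N by apply: leq_trans kn; rewrite leq_pmull.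
(* An interval meeting the one at [i0] starts at $i_0 + r' - r$. Here [s] stands for $r' - r + k$, a
   natural number, and adding [n - k] undoes the shift modulo [n]. *)
pose f (s : 'I_(2 * k)) := cyclic_interval k (Ordinal (ltn_pmod (i0 + (s + (n - k))) n0)).
rewrite -[leqRHS](card_ord (2 * k)); apply: leq_trans (leq_imset_card f _).
apply: subset_leq_card; apply/fintype.subsetP => I; rewrite inE => /andP[/imsetP[i _ ->]].
rewrite -setI_eq0 => /set0Pn[j]; rewrite finset.in_setI !in_cyclic_interval.
move=> /andP[/existsP[r /eqP jr] /existsP[r' /eqP jr']].
have sk : (r' + (k - r) < 2 * k)%N.
  by rewrite mul2n -addnn -addSn leq_add// leq_subr.
apply/imsetP; exists (Ordinal sk) => //=.
congr cyclic_interval; apply: val_inj => /=.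
have -> : (i0 + (r' + (k - r) + (n - k)) = i0 + r' + (n - r))%N.
  by have := ltn_ord r; lia.
rewrite -modnDml -jr' jr modnDml -addnA subnKC ?modnDr ?modn_small//.
by rewrite ltnW// (leq_trans (ltn_ord r)).
Qed.

Lemma card_circ_blocks : #|circ_blocks n k| = (n ^ 2)%N.
Proof. by rewrite circ_blocksE cardsX card_intervals mulnn. Qed.

Lemma card_circ_blocks_mem c :
  (#|[set B in circ_blocks n k | c \in cells B]%SET| <= k ^ 2)%N.
Proof.
case: c => i j.
have -> : [set B in circ_blocks n k | (i, j) \in cells B]%SET =
   finset.setX [set I in intervals | i \in I]%SET [set I in intervals | j \in I]%SET.
  apply/setP => -[S T]; rewrite inE circ_blocksE !finset.in_setX !inE /=.
  by rewrite andbACA.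
by rewrite cardsX -mulnn leq_mul// card_intervals_mem.
Qed.

Lemma card_circ_blocks_meet B0 : B0 \in circ_blocks n k ->
  (#|[set B in circ_blocks n k | ~~ [disjoint cells B & cells B0]]%SET| <= (2 * k) ^ 2)%N.
Proof.
case: B0 => S0 T0; rewrite circ_blocksE finset.in_setX => /andP[B1 B2].
have -> : [set B in finset.setX intervals intervals | ~~ [disjoint cells B & cells (S0, T0)]]%SET =
   finset.setX [set I in intervals | ~~ [disjoint I & S0]]%SET
               [set I in intervals | ~~ [disjoint I & T0]]%SET.
  apply/setP => -[S T]; rewrite !inE disjoint_cells negb_or /=.
  by rewrite andbACA.
by rewrite cardsX -mulnn leq_mul// card_intervals_meet.
Qed.

End circular_geometry.

(** * The circular mixture is close to the null law *)

Section circ_close.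
Context {R : realType}.
Local Notation RR := (measurableTypeR R).

Section fixed.
Context {n m k : nat}.
Hypotheses (m0 : (0 < m)%N) (k0 : (0 < k)%N) (mkn : (m * k <= n)%N).
Local Notation O := (@ordered_placements n m (circ_blocks n k)).
Variable x : 'I_m -> 'I_k * 'I_k -> R.

Let kn : (k <= n)%N. Proof. by apply: leq_trans mkn; rewrite leq_pmull. Qed.

Let sub_nc t : t \in O -> t \in @ordered_placements n m (blocks n k).
Proof. exact: (fintype.subsetP (ordered_placements_sub _ (circ_blocks_sub_blocks kn))). Qed.

Lemma sum_template_weight_le (h : R -> R) t : t \in O -> h 0 = 0 ->
  (forall l u, 0 <= h (x l u)) ->
  \sum_c h (template_weight x t c) <= \sum_l \sum_u h (x l u).
Proof.
move=> tO h0 hx0.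
have hE c : h (template_weight x t c) = template_weight (fun l u => h (x l u)) t c.
  by rewrite /template_weight; case: template_cell.
under eq_bigr do rewrite hE.
rewrite (eq_bigr (fun c => template_weight (fun l u => h (x l u)) t (c.1, c.2))); last by move=> [].
rewrite -(pair_bigA _ (fun i j => template_weight (fun l u => h (x l u)) t (i, j))) /=.
apply: le_trans (ler_sum _ (fun i _ => sum_row_weight_le hx0 i (sub_nc tO))) _.
rewrite exchange_big; apply: ler_sum => l _ /=.
apply: (@le_trans _ _ (\sum_(i in (t l).1)
    at_rank (fun u => \sum_v h (x l (u, v))) (t l).1 i)).
  rewrite [leRHS]big_mkcond; apply: ler_sum => i _ /=.
  by case: ifP; rewrite ?mul1r ?mul0r.
apply: le_trans (sum_at_rank_le _ _) _; first by move=> u; exact: sumr_ge0.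
by rewrite pair_bigA; apply: ler_sum => -[].
Qed.

Variable th : R.
Hypothesis x0 : forall l u, 0 <= x l u.
Hypothesis sum_x : forall l, \sum_u x l u <= (k ^ 2)%:R * th.
Hypothesis sum_ex : forall l, \sum_u expR ((k ^ 2)%:R * x l u) <=
   (k ^ 2)%:R * expR ((k ^ 2)%:R * th).

Let W := expR ((k ^ 2)%:R * th).
Let k2 : 0 < (k ^ 2)%:R :> R. Proof. by rewrite ltr0n expn_gt0 k0. Qed.
Let n0 : (0 < n)%N. Proof. by apply: leq_trans kn. Qed.
Let n2 : 0 < (n ^ 2)%:R :> R. Proof. by rewrite ltr0n expn_gt0 n0. Qed.
Let th0 : 0 <= (k ^ 2)%:R * th.
Proof. by apply: le_trans (sum_x (Ordinal m0)); exact: sumr_ge0. Qed.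
Let W1 : 0 <= W - 1. Proof. by rewrite subr_ge0 -expR0 ler_expR. Qed.

Let overlap_total_le t t' : t \in O -> overlap x t t' <= m%:R * ((k ^ 2)%:R * th).
Proof.
move=> tO; apply: (@le_trans _ _ (\sum_c template_weight x t c)).
  apply: ler_sum => c _; rewrite ler_piMl ?template_weight_ge0//.
  by rewrite lern1 leq_b1.
apply: le_trans (sum_template_weight_le (h := id) tO _ _) _ => //.
apply: le_trans (ler_sum _ (fun l _ => sum_x l)) _.
by rewrite sumr_const card_ord [leRHS]mulr_natl.
Qed.

Let f t (B : block n) : R := expR (\sum_(c in cells B) template_weight x t c).

Let f1 t B : 1 <= f t B.
Proof.
by rewrite -expR0 ler_expR sumr_ge0// => c _; exact: template_weight_ge0.
Qed.

(** Every cell covered by [t'] lies in some block of [t'], so its weight occurs in at least one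
    factor. *)
Let expR_overlap_le t t' : expR (overlap x t t') <= \prod_l f t (t' l).
Proof.
rewrite -expR_sum ler_expR.
rewrite (eq_bigr (fun l => \sum_c (c \in cells (t' l))%:R * template_weight x t c)); last first.
  move=> l _; rewrite big_mkcond; apply: eq_bigr => c _.
  by case: (_ \in _); rewrite ?mul1r ?mul0r.
rewrite exchange_big; apply: ler_sum => c _ /=.
rewrite -mulr_suml ler_wpM2r ?template_weight_ge0//.
case E : (template_cell t' c) => [lu|] /=; last by apply: sumr_ge0.
move: E; rewrite /template_cell /covering; case: pickP => // l cl _.
by rewrite (bigD1 l)//= cl lerDl sumr_ge0.
Qed.

(* Jensen's inequality, padding the cells of [B] to [k ^ 2] terms. *)
Let f_sub1_le t B : (#|cells B| <= k ^ 2)%N ->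
  f t B - 1 <= (k ^ 2)%:R^-1 *
     \sum_(c in cells B) (expR ((k ^ 2)%:R * template_weight x t c) - 1).
Proof.
move=> Bk; set s := \sum_(c in cells B) template_weight x t c.
rewrite ler_pdivlMl// -subr_ge0.
have : \sum_(c in cells B) (expR s * (1 + ((k ^ 2)%:R * template_weight x t c - s))) <=
    \sum_(c in cells B) expR ((k ^ 2)%:R * template_weight x t c).
  apply: ler_sum => c _.
  rewrite [X in _ <= expR X](_ : _ = s + ((k ^ 2)%:R * template_weight x t c - s)); last by ring.
  by rewrite expRD ler_wpM2l ?expR_ge0// expR_ge1Dx.
rewrite -mulr_sumr big_split /= sumr_const sumrB -mulr_sumr -/s.
rewrite sumrB sumr_const -[s *+ _]mulr_natl -/(f t B).
have es : 1 >= (1 - s) * expR s.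
  rewrite -[leRHS](expRxMexpNx_1 s) mulrC ler_wpM2l ?expR_ge0//.
  by apply: le_trans (expR_ge1Dx _).
have d0 : 0 <= (k ^ 2)%:R - #|cells B|%:R :> R by rewrite subr_ge0 ler_nat.
have := ler_wpM2l d0 es; rewrite mulr1 -[X in _ <= _ - X]/(#|cells B|%:R) /f -/s.
set e := expR s; set b := #|cells B|%:R; set q := (k ^ 2)%:R; set S := \sum_(_ in _) _.
rewrite [X in _ - X - _](_ : _ = b); last by rewrite sumr_const.
move=> h1 h2; have -> : S - b - q * (e - 1) = (S - e * (b + (q * s - b * s))) +
   ((q - b) - (q - b) * ((1 - s) * e)) by ring.
by rewrite addr_ge0// subr_ge0.
Qed.

(** Double counting: a cell lies in at most [k ^ 2] circular blocks, which cancels the factor from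
    Jensen's inequality. The remaining sum runs over the cells of the templates and is controlled by
    [sum_ex]. *)
Let sum_f_le t : (2 * k <= n)%N -> t \in O ->
  \sum_(B in circ_blocks n k) (f t B - 1) <= m%:R * (k ^ 2)%:R * (W - 1).
Proof.
move=> kn2 tO.
have cellsk B : B \in circ_blocks n k -> (#|cells B| <= k ^ 2)%N.
  move=> /(fintype.subsetP (circ_blocks_sub_blocks kn)); rewrite inE => /andP[/eqP B1 /eqP B2].
  by rewrite cardsX B1 B2 mulnn.
apply: le_trans (ler_sum _ (fun B HB => f_sub1_le t (cellsk B HB))) _.
pose h c := expR ((k ^ 2)%:R * template_weight x t c) - 1.
have h0 c : 0 <= h c.
  by rewrite subr_ge0 -expR0 ler_expR mulr_ge0// template_weight_ge0.
rewrite -mulr_sumr ler_pdivrMl//.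
apply: (@le_trans _ _ ((k ^ 2)%:R * \sum_c h c)).
  rewrite (eq_bigr (fun B => \sum_c (c \in cells B)%:R * h c)); last first.
    move=> B _; rewrite big_mkcond; apply: eq_bigr => c _.
    by case: (_ \in _); rewrite ?mul1r ?mul0r.
  rewrite exchange_big mulr_sumr; apply: ler_sum => c _ /=.
  rewrite -mulr_suml ler_wpM2r// -natr_sum ler_nat.
  apply: leq_trans (card_circ_blocks_mem kn2 c).
  rewrite -sum1_card big_mkcond [leqRHS]big_mkcond; apply: leq_sum => B _.
  by rewrite inE; case: (_ \in circ_blocks _ _).
rewrite ler_pM2l// -mulrA.
apply: le_trans (sum_template_weight_le (h := fun y => expR ((k ^ 2)%:R * y) - 1) tO _ _) _.
- by rewrite mulr0 expR0 subrr.
- by move=> l u; rewrite subr_ge0 -expR0 ler_expR mulr_ge0.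
apply: (@le_trans _ _ (\sum_(l < m) (k ^ 2)%:R * (W - 1))); last first.
  by rewrite sumr_const card_ord [leRHS]mulr_natl.
apply: ler_sum => l _.
rewrite sumrB sumr_const card_prod card_ord mulnn.
by rewrite mulrBr mulr1 lerD2r; exact: sum_ex.
Qed.

Let update_in t l B : t \in O ->
  (update t l B \in O) = (B \in circ_blocks n k) &&
     [forall l', (l' != l) ==> [disjoint cells B & cells (t l')]].
Proof.
move=> /ordered_placementsP[tb td].
apply/ordered_placementsP/andP => [[H1 H2]|[HB /forallP Hd]]; split.
- by have := H1 l; rewrite ffunE eqxx.
- apply/forallP => l'; apply/implyP => l'l; have := H2 l l'.
  by rewrite !ffunE eqxx (negbTE l'l); apply; rewrite eq_sym.
- by move=> l'; rewrite ffunE; case: eqP.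
- move=> l1 l2 l12; rewrite !ffunE; case: eqP => [l1l|/eqP l1l]; case: eqP => [l2l|/eqP l2l].
  + by rewrite l1l l2l eqxx in l12.
  + by have /implyP := Hd l2; apply.
  + by rewrite disjoint_sym; have /implyP := Hd l1; apply.
  + exact: td.
Qed.

(** Each block excludes at most [(2 * k) ^ 2] of the [n ^ 2] positions. In total this is $4 m k^2
    \le n^2/2$, because $8k \le n$ and $mk \le n$. *)
Let card_update t l : (8 * k <= n)%N -> t \in O ->
  (n ^ 2 <= 2 * #|[set B | update t l B \in O]%SET|)%N.
Proof.
move=> kn8 tO; have kn2 : (2 * k <= n)%N by apply: leq_trans kn8; rewrite leq_mul2r orbT.
have tb l' : t l' \in circ_blocks n k by move/ordered_placementsP: tO => [].
have H : (#|circ_blocks n k| <= #|[set B | update t l B \in O]%SET| +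
    \sum_l' #|[set B in circ_blocks n k | ~~ [disjoint cells B & cells (t l')]]%SET|)%N.
  rewrite -!sum1_card big_mkcond [in leqRHS]big_mkcond /=.
  under [X in (_ <= _ + X)%N]eq_bigr do rewrite -sum1_card big_mkcond /=.
  rewrite exchange_big -big_split /=; apply: leq_sum => B _.
  case: ifPn => // HB; rewrite inE update_in// HB /=.
  case: ifPn => // /forallPn[l']; rewrite negb_imply => /andP[_ nd].
  by rewrite add0n (bigD1 l')//= inE HB nd.
have H2 : (\sum_l' #|[set B in circ_blocks n k | ~~ [disjoint cells B & cells (t l')]]%SET| <=
     m * (2 * k) ^ 2)%N.
  rewrite -[X in (_ <= X * _)%N](card_ord m) -sum_nat_const; apply: leq_sum => l' _.
  exact: card_circ_blocks_meet.
have := leq_trans H (leq_add (leqnn _) H2); rewrite card_circ_blocks//.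
have : (8 * (m * k ^ 2) <= n ^ 2)%N.
  rewrite -!mulnn (_ : 8 * _ = 8 * k * (m * k))%N; last by lia.
  exact: leq_mul.
rewrite expnMn; lia.
Qed.

Lemma circ_second_moment_le t : t \in O ->
  \sum_(t' in O) expR (overlap x t t') <=
  expR (64 * (m%:R ^+ 2 * k%:R ^+ 2 * (W - 1) / n%:R ^+ 2)) * #|O|%:R.
Proof.
move=> tO.
have m0r : 0 < m%:R :> R by rewrite ltr0n.
have n0r : 0 < n%:R :> R by rewrite ltr0n.
set q := m%:R ^+ 2 * k%:R ^+ 2 * (W - 1) / n%:R ^+ 2.
have q0 : 0 <= q by rewrite divr_ge0 ?exprn_ge0// mulr_ge0// mulr_ge0 ?exprn_ge0.
(* For $n < 8k$ the quotient $m (8k)^2 / n^2$ is at least 1, so the total weight is already below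
   [64 * q], where $64 = 8^2$. *)
have [kn8|kn8] := leqP (8 * k) n; last first.
  apply: le_trans (ler_sum _ (fun t' _ => _ : _ <= expR (64 * q))) _; last first.
    by rewrite sumr_const mulr_natr.
  move=> t' _; rewrite ler_expR; apply: le_trans (overlap_total_le t' tO) _.
  apply: (@le_trans _ _ (m%:R * (W - 1))).
    by rewrite ler_wpM2l// lerBrDl expR_ge1Dx.
  rewrite /q [leRHS](_ : _ = (m%:R * (W - 1)) * (m%:R * (8 * k%:R) ^+ 2 / n%:R ^+ 2)); last by field; rewrite gt_eqF.
  rewrite ler_peMr ?mulr_ge0// ler_pdivlMr ?exprn_gt0// mul1r.
  rewrite -[leLHS]mul1r ler_pM ?exprn_ge0// ?ler1n//.
  by rewrite lerXn2r ?nnegrE ?mulr_ge0// -natrM ler_nat ltnW.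
apply: le_trans (ler_sum _ (fun t' _ => expR_overlap_le t t')) _.
have kn2 : (2 * k <= n)%N by apply: leq_trans kn8; rewrite leq_mul2r orbT.
(* [a - 1] is twice the bound on the mean of [f t B - 1] over all [n ^ 2] positions, as at least
   half of them are available. *)
pose a : R := 1 + 2 * (m%:R * (k ^ 2)%:R * (W - 1)) / (n ^ 2)%:R.
have a0 : 0 <= 2 * (m%:R * (k ^ 2)%:R * (W - 1)) / (n ^ 2)%:R by rewrite divr_ge0 ?mulr_ge0.
apply: le_trans (@resampling_le R _ _ O (f t) a _ _ _) _.
- by rewrite addr_ge0.
- by move=> B; rewrite (le_trans _ (f1 t B)).
- move=> t1 l t1O.
  set D := #|_|.
  apply: (@le_trans _ _ (\sum_(B | update t1 l B \in O) 1 +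
     \sum_(B in circ_blocks n k) (f t B - 1))).
    rewrite (eq_bigr (fun B => 1 + (f t B - 1))) => [|B _]; last by ring.
    rewrite big_split lerD2l /= [leLHS]big_mkcond [leRHS]big_mkcond.
    apply: ler_sum => B _; rewrite update_in//.
    by case: (B \in _) => //=; case: ifP => // _; rewrite subr_ge0.
  rewrite (_ : \sum_(B | _) 1 = D%:R); last first.
    by rewrite sumr_const /D; congr (_ *+ _); apply: eq_card => B; rewrite inE.
  apply: le_trans (lerD (lexx _) (sum_f_le kn2 tO)) _.
  rewrite /a mulrDl mul1r lerD2l.
  have : (n ^ 2)%:R <= (2 * D)%:R :> R by rewrite ler_nat; exact: card_update.
  rewrite natrM => hD.
  rewrite [leRHS](_ : _ = m%:R * (k ^ 2)%:R * (W - 1) * (2 * D%:R / (n ^ 2)%:R)); last by field; rewrite gt_eqF.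
  by rewrite ler_peMr ?mulr_ge0// ler_pdivlMr// mul1r.
rewrite card_ord ler_wpM2r//.
apply: (@le_trans _ _ (expR (2 * (m%:R * (k ^ 2)%:R * (W - 1)) / (n ^ 2)%:R) ^+ m)).
  by rewrite lerXn2r ?nnegrE ?expR_ge0 ?addr_ge0// expR_ge1Dx.
rewrite -expRM_natl ler_expR.
rewrite (_ : m%:R * _ = 2 * q); last by rewrite /q !natrX; field; rewrite gt_eqF.
by rewrite ler_wpM2r// ler_nat.
Qed.

End fixed.

(** Neither conditioning nor truncation is used: in [mixture_close] the index [j] is trivial, [h]
    numbers the ordered placements and [s = 1]. *)
Lemma circ_close (n m k : nat) (P : 'I_m -> 'I_k * 'I_k -> probability RR R) (th : R) :
  (0 < m)%N -> (0 < k)%N -> (m * k <= n)%N ->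
  (forall l u, P l u `<< @std_normal R) -> (Theta_star P <= th%:E)%E ->
  let O := @ordered_placements n m (circ_blocks n k) in
  forall (e : R) (A : set _), 0 < e -> measurable A ->
  `|\sum_(t in O) fine (matrix_law (template_law P t) A) / #|O|%:R
    - fine (law_H0 n A)| <=
  e / 2 + (expR (64 * (m%:R ^+ 2 * k%:R ^+ 2 * (expR (k%:R ^+ 2 * th) - 1) / n%:R ^+ 2)) - 1) / (2 * e).
Proof.
move=> m0 k0 mkn P_ac HT O e A e0 mA.
have [x [x0 xE hx]] := Theta_star_chi2 m0 k0 P_ac HT.
have sum_x l : \sum_u x l u <= (k ^ 2)%:R * th by exact: (sum_chi2_le m0 k0 (hx l)).
have sum_ex l := sum_expR_chi2_le m0 k0 (hx l).
have O0 : (0 < #|O|)%N.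
  by have [t tO] := ordered_circ_placements_neq0 k0 mkn; apply/card_gt0P; exists t.
have O0r : 0 < #|O|%:R :> R by rewrite ltr0n.
set V := expR (64 * _).
have := @mixture_close R n m k P x O unit 'I_#|O| [set: unit]%SET
   (fun _ h => enum_val h) predT V 1 e A P_ac xE O0 _ _ _ _ e0 mA.
rewrite cardsT card_unit card_ord => H.
apply: le_trans (H _ _ _ _ _) _ => //.
- by move=> F; rewrite sumr_const cardsT card_unit mulr1n mul1r [RHS]big_enum_val.
- rewrite sumr_const cardsT card_unit mulr1n mul1r.
  rewrite -(big_enum_val (fun t => \sum_(h' < #|O|) (predT t)%:R * expR (overlap x t (enum_val h')))).
  apply: (@le_trans _ _ (\sum_(t in O) V * #|O|%:R)); last first.
    by rewrite sumr_const -[leLHS]mulr_natr -mulrA -expr2.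
  apply: ler_sum => t tO.
  rewrite -(big_enum_val (fun t' => (predT t)%:R * expR (overlap x t t'))) /=.
  rewrite (eq_bigr (fun t' => expR (overlap x t t'))) => [|t' _]; last by rewrite mul1r.
  have := circ_second_moment_le m0 k0 mkn x0 sum_x sum_ex tO.
  by rewrite natrX.
- by rewrite sumr_const divff// gt_eqF.
- by rewrite subrr addr0 lerD2l ler_wpM2r ?invr_ge0 ?mulr_ge0 ?(ltW e0)//; lra.
Qed.

End circ_close.

(** * Asymptotics *)

Section asymptotics.
Context {R : realType}.
Local Notation RR := (measurableTypeR R).

Lemma ordered_law_H1_close (n m k : nat) (P : 'I_m -> 'I_k * 'I_k -> probability RR R)
    (bl : {set block n}) (b : R) :
  (forall B, B \in bl -> cells B != finset.set0) ->
  (0 < #|@ordered_placements n m bl|)%N ->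
  (forall A, measurable A ->
   `|\sum_(t in ordered_placements bl)
       fine (matrix_law (template_law P t) A) / #|@ordered_placements n m bl|%:R
     - fine (law_H0 n A)| <= b) ->
  law_H1 P (placements m bl) setT = 1%E /\
  (forall A, measurable A ->
   (`|law_H0 n A - law_H1 P (placements m bl) A| <= b%:E)%E).
Proof.
move=> blc O0 H; set O := ordered_placements bl in O0 H *.
have O0r : 0 < #|O|%:R :> R by rewrite ltr0n.
have HE A : measurable A -> law_H1 P (placements m bl) A =
    (\sum_(t in O) fine (matrix_law (template_law P t) A) / #|O|%:R)%:E.
  move=> mA; rewrite law_H1_ordered// -sumEFin; apply: eq_bigr => t _.
  by rewrite mulrC EFinM fineK// fin_num_measure.
split.
  rewrite HE// (eq_bigr (fun=> #|O|%:R^-1)); last first.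
    move=> t _; rewrite (_ : fine _ = 1) ?mul1r//.
    by rewrite (_ : matrix_law _ _ = 1%E)//; exact: probability_setT.
  by rewrite sumr_const -[X in X%:E]mulr_natr mulVf// gt_eqF.
move=> A mA; rewrite HE//.
rewrite -[X in (`|X - _|)%E](@fineK _ (law_H0 n A)) ?fin_num_measure//.
by rewrite -EFinB /= lee_fin distrC; exact: H.
Qed.

Lemma cvge_squeeze (f : nat -> \bar R) (a : R) :
  (forall e : R, 0 < e -> \forall n \near \oo, ((a - e)%:E <= f n <= (a + e)%:E)%E) ->
  f @ \oo --> a%:E.
Proof.
move=> H; apply/fine_cvgP; split.
  have := H 1 ltr01; apply: filterS => n /andP[h1 h2].
  by rewrite fin_numE; apply/andP; split; apply/eqP => E; rewrite E in h1 h2.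
apply/cvgrPdist_le => e e0; have := H e e0; apply: filterS => n /=.
by case: (f n) => [r| |] //=; rewrite ?lee_fin ?leye_eq ?andbF ?leeNy_eq ?ler_distlC.
Qed.

(** The total mass is part of the hypothesis because the bound on the risk from above is the mass of
    [Q n], and a mixture over an empty family would have mass 0. *)
Lemma dTV_risk_cvg (d : nat -> measure_display) (T : forall n, measurableType (d n))
    (P : forall n, probability (T n) R) (Q : forall n, {finite_measure set (T n) -> \bar R}) :
  (forall e : R, 0 < e -> \forall n \near \oo, Q n setT = 1%E /\
     forall A, measurable A -> (`|P n A - Q n A| <= e%:E)%E) ->
  dTV (P n) (Q n) @[n --> \oo] --> 0%E /\ minimal_risk (P n) (Q n) @[n --> \oo] --> 1%E.
Proof.
move=> H; split; apply: cvge_squeeze => e e0; have := H e e0; apply: filterS => n [Q1 HA].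
- apply/andP; split; last by rewrite add0r; exact: dTV_le.
  by apply: le_trans (dTV_ge0 _ _); rewrite sub0r lee_fin oppr_le0 ltW.
- have /andP[h1 h2] := minimal_risk_bounds Q1 HA.
  by rewrite EFinB h1 /=; apply: le_trans h2 _; rewrite lee_fin lerDl ltW.
Qed.

Lemma near_expR_ln1D (delta : nat -> R) (C e : R) : (forall n, 0 < delta n) ->
  delta n @[n --> \oo] --> 0 -> 0 <= C -> 0 < e ->
  \forall n \near \oo, expR (C * ln (1 + delta n)) - 1 <= e.
Proof.
move=> d0 dcvg C0 e0.
have c0 : 0 < ln (1 + e) / (C + 1) by rewrite divr_gt0 ?ltr_wpDl// ln_gt0// ltrDl.
move/cvgr0_norm_le : dcvg => /(_ _ c0); apply: filterS => n.
rewrite ger0_norm ?(ltW (d0 n))// ler_pdivlMr ?ltr_wpDl// => h.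
rewrite lerBlDr [leRHS]addrC -[leRHS]lnK; last by rewrite posrE ltr_wpDr// ltW.
rewrite ler_expR; apply: le_trans h; rewrite mulrC.
have l0 : 0 <= ln (1 + delta n) by rewrite ln_ge0// lerDl ltW.
apply: ler_pM => //; last by rewrite lerDl.
by apply: le_ln1Dx; apply: lt_trans (d0 n); rewrite ltrN10.
Qed.

End asymptotics.

Theorem theorem3 (R : realType) (m k : nat -> nat)
    (P : forall n, 'I_(m n) -> 'I_(k n) * 'I_(k n) ->
         probability (measurableTypeR R) R)
    (delta : nat -> R)
    (m_gt0 : \forall n \near \oo, (0 < m n)%N)
    (k_gt0 : \forall n \near \oo, (0 < k n)%N)
    (mk_le : \forall n \near \oo, (m n * k n <= n)%N)
    (P_ac : forall n l u, P n l u `<< @std_normal R)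
    (delta_gt0 : forall n, 0 < delta n)
    (delta_cvg0 : delta n @[n --> \oo] --> 0) :
  ((\forall n \near \oo,
      (Theta_star (@P n) <=
       (Num.min (k n)%:R^-1
          (n%:R ^+ 2 * ln (1 + delta n)
           / (2 * (m n)%:R ^+ 2 * (k n)%:R ^+ 4)))%:E)%E) ->
   dTV (law_H0 n) (law_H1 (@P n) (nc_family n (k n) (m n)))
     @[n --> \oo] --> 0%E /\
   minimal_risk (law_H0 n) (law_H1 (@P n) (nc_family n (k n) (m n)))
     @[n --> \oo] --> 1%E) /\
  ((\forall n \near \oo, (2 * k n <= n)%N) ->
   (\forall n \near \oo,
      (Theta_star (@P n) <=
       ((k n)%:R ^- 2 *
        ln (1 + n%:R ^+ 2 * ln (1 + delta n)
                / (4 * (k n)%:R ^+ 2 * (m n)%:R ^+ 2)))%:E)%E) ->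
   dTV (law_H0 n) (law_H1 (@P n) (circ_family n (k n) (m n)))
     @[n --> \oo] --> 0%E /\
   minimal_risk (law_H0 n) (law_H1 (@P n) (circ_family n (k n) (m n)))
     @[n --> \oo] --> 1%E).
Proof.
split=> [HT|_ HT]; apply: dTV_risk_cvg => e e0.
(* [nc_close] is applied with [e / 2]; the error is then at most $e/4 + (e^2/4 + 2\eta)/e + \eta$,
   and this choice of [eta] keeps it below [e]. *)
- pose eta : R := Num.min (e / 4) (e ^+ 2 / 8).
  have eta0 : 0 < eta by rewrite lt_min !divr_gt0// exprn_gt0.
  have [K K0 HK] := @nc_close R _ eta0.
  have e20 : 0 < e ^+ 2 / 4 by rewrite divr_gt0// exprn_gt0.
  have K20 : 0 <= K / 2 by rewrite divr_ge0.
  have hd := near_expR_ln1D delta_gt0 delta_cvg0 K20 e20.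
  pose thb n : R := n%:R ^+ 2 * ln (1 + delta n) / (2 * (m n)%:R ^+ 2 * (k n)%:R ^+ 4).
  pose th n : R := Num.min (k n)%:R^-1 (thb n).
  near=> n.
  have m0 : (0 < m n)%N by near: n.
  have k0 : (0 < k n)%N by near: n.
  have mkn : (m n * k n <= n)%N by near: n.
  have HTn : (Theta_star (@P n) <= (th n)%:E)%E by near: n.
  have hdn : expR (K / 2 * ln (1 + delta n)) - 1 <= e ^+ 2 / 4 by near: n.
  have n0 : (0 < n)%N by apply: leq_trans mkn; rewrite muln_gt0 m0.
  have n0r : 0 < n%:R :> R by rewrite ltr0n.
  have m0r : 0 < (m n)%:R :> R by rewrite ltr0n.
  have k0r : 0 < (k n)%:R :> R by rewrite ltr0n.
  have l0 : 0 < ln (1 + delta n) by rewrite ln_gt0// ltrDl.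
  have th0 : 0 < th n.
    by rewrite lt_min invr_gt0 k0r/= divr_gt0// ?mulr_gt0// exprn_gt0.
  have thk : th n <= (k n)%:R^-1 by rewrite ge_min lexx.
  have L2 : K * ((m n)%:R ^+ 2 * (k n)%:R ^+ 4 * th n / n%:R ^+ 2) <= K / 2 * ln (1 + delta n).
    rewrite -[leRHS]mulrA ler_wpM2l// ler_pdivrMr ?exprn_gt0//.
    apply: (@le_trans _ _ ((m n)%:R ^+ 2 * (k n)%:R ^+ 4 * thb n)).
      by rewrite ler_wpM2l ?mulr_ge0 ?exprn_ge0// ge_min lexx orbT.
    rewrite le_eqVlt; apply/orP; left; apply/eqP; rewrite /thb; field.
    by rewrite !gt_eqF.
  apply: ordered_law_H1_close.
  - by move=> B; exact: blocks_cells_neq0.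
  - have [t tO] := ordered_circ_placements_neq0 k0 mkn.
    apply/card_gt0P; exists t; apply: (fintype.subsetP _ _ tO).
    apply: ordered_placements_sub; apply: circ_blocks_sub_blocks.
    by apply: leq_trans mkn; rewrite leq_pmull.
  - move=> A mA.
    apply: le_trans (HK n _ _ (@P n) (th n) m0 k0 mkn (@P_ac n) HTn th0 thk (e / 2) A _ mA) _.
      by rewrite divr_gt0.
    have h1 : expR (K * ((m n)%:R ^+ 2 * (k n)%:R ^+ 4 * th n / n%:R ^+ 2)) - 1 <= e ^+ 2 / 4.
      by apply: le_trans hdn; rewrite lerD2r ler_expR.
    have eta1 : eta <= e / 4 by rewrite ge_min lexx.
    have eta2 : eta <= e ^+ 2 / 8 by rewrite ge_min lexx orbT.
    have h2 : (expR (K * ((m n)%:R ^+ 2 * (k n)%:R ^+ 4 * th n / n%:R ^+ 2)) - 1 + 2 * eta)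
        / (2 * (e / 2)) <= e / 2.
      have -> : 2 * (e / 2) = e by field.
      rewrite ler_pdivrMr// [leRHS](_ : _ = e ^+ 2 / 2); last by field.
      lra.
    lra.
- have e20 : 0 < e ^+ 2 by rewrite exprn_gt0.
  (* 16 is the constant 64 of the second moment divided by the 4 in the threshold. *)
  have hd := near_expR_ln1D delta_gt0 delta_cvg0 (ler0n R 16) e20.
  pose th n : R := (k n)%:R ^- 2 *
        ln (1 + n%:R ^+ 2 * ln (1 + delta n) / (4 * (k n)%:R ^+ 2 * (m n)%:R ^+ 2)).
  near=> n.
  have m0 : (0 < m n)%N by near: n.
  have k0 : (0 < k n)%N by near: n.
  have mkn : (m n * k n <= n)%N by near: n.
  have HTn : (Theta_star (@P n) <= (th n)%:E)%E by near: n.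
  have hdn : expR (16 * ln (1 + delta n)) - 1 <= e ^+ 2 by near: n.
  have n0 : (0 < n)%N by apply: leq_trans mkn; rewrite muln_gt0 m0.
  have n0r : 0 < n%:R :> R by rewrite ltr0n.
  have m0r : 0 < (m n)%:R :> R by rewrite ltr0n.
  have k0r : 0 < (k n)%:R :> R by rewrite ltr0n.
  have l0 : 0 < ln (1 + delta n) by rewrite ln_gt0// ltrDl.
  have kn : (k n <= n)%N by apply: leq_trans mkn; rewrite leq_pmull.
  apply: ordered_law_H1_close.
  - move=> B /(fintype.subsetP (circ_blocks_sub_blocks kn)).
    exact: blocks_cells_neq0.
  - have [t tO] := ordered_circ_placements_neq0 k0 mkn.
    by apply/card_gt0P; exists t.
  - move=> A mA.
    apply: le_trans (circ_close m0 k0 mkn (@P_ac n) HTn e0 mA) _.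
    have -> : 64 * ((m n)%:R ^+ 2 * (k n)%:R ^+ 2 *
       (expR ((k n)%:R ^+ 2 * th n) - 1) / n%:R ^+ 2) = 16 * ln (1 + delta n).
      rewrite /th mulVKf ?gt_eqF ?exprn_gt0// lnK; last first.
        by rewrite posrE addr_gt0// divr_gt0// !mulr_gt0// exprn_gt0.
      by field; rewrite !gt_eqF.
    have : (expR (16 * ln (1 + delta n)) - 1) / (2 * e) <= e / 2.
      by rewrite ler_pdivrMr ?mulr_gt0// [leRHS](_ : _ = e ^+ 2); last by field.
    lra.
Unshelve. all: by end_near.
Qed.
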